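(* Let $d\ge2$ and let $\mathbb{F}_d$ be the free group on $d$ generators. For each $p\in[2,\infty)$, the $C^*$-algebra $C^*_{\ell_p}(\mathbb{F}_d)$ has a unique tracial state, namely $\tau\circ\lambda_p$, where $\lambda_p$ is the canonical quotient map from $C^*_{\ell_p}(\mathbb{F}_d)$ onto the reduced group $C^*$-algebra $C^*_\lambda(\mathbb{F}_d)$ and $\tau$ is the unique tracial state on $C^*_\lambda(\mathbb{F}_d)$.
   Context: Let $\Gamma$ be a countable discrete group. For a unitary representation $\pi$ of $\Gamma$ on a Hilbert space $\mathcal{H}$ and $\xi,\eta\in\mathcal{H}$, put $\pi_{\xi,\eta}(s)=\langle\pi(s)\xi,\eta\rangle$. For $p\in[1,\infty)$, a unitary representation $\pi$ of $\Gamma$ on $\mathcal{H}$ is an $\ell_p$-representation if there is a dense subspace $\mathcal{H}_0\subset\mathcal{H}$ with $\pi_{\xi,\eta}\in\ell_p(\Gamma)$ for all $\xi,\eta\in\mathcal{H}_0$. $C_{\ell_p}^*(\Gamma)$ is the completion of the group ring $\mathbb{C}\Gamma$ in the norm $\|f\|_{\ell_p}=\sup\{\|\pi(f)\|:\pi\text{ is an }\ell_p\text{-representation}\}$, where $\pi(f)=\sum_{s}f(s)\pi(s)$. The left regular representation $\lambda$ of $\Gamma$ is an $\ell_p$-representation, so the identity map of $\mathbb{C}\Gamma$ extends to a surjective $*$-homomorphism $\lambda_p:C^*_{\ell_p}(\Gamma)\to C^*_\lambda(\Gamma)$, the canonical quotient map. *)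

(* Defs.v *)
From HB Require Import structures.
From mathcomp Require Import all_boot all_order all_algebra.
From mathcomp Require Import finmap complex monalg.
From mathcomp Require Import all_classical all_reals all_analysis.

Set Implicit Arguments.
Unset Strict Implicit.
Unset Printing Implicit Defensive.

Import Order.TTheory GRing.Theory Num.Theory.
Import numFieldNormedType.Exports.

Local Open Scope classical_set_scope.
Local Open Scope ring_scope.

Section FreeGroup.
Variable d : nat.

(* (i, true) is the i-th generator and (i, false) its inverse *)
Definition letter : Type := ('I_d * bool)%type.
HB.instance Definition _ := Countable.on letter.

Definition linv (x : letter) : letter := (x.1, ~~ x.2).

Definition reduced (w : seq letter) : bool :=
  sorted (fun x y => y != linv x) w.

(* the reduced form of x :: w when w is reduced *)
Definition lcons (x : letter) (w : seq letter) : seq letter :=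
  if w is y :: w' then if y == linv x then w' else x :: w else [:: x].

Record free_group := FreeGroup { fg_word :> seq letter ; _ : reduced fg_word }.

HB.instance Definition _ := [isSub for fg_word].
HB.instance Definition _ := [Countable of free_group by <:].

Lemma linvK : involutive linv.
Proof. by case=> i b; rewrite /linv /= negbK. Qed.

Lemma reduced_behead x w : reduced (x :: w) -> reduced w.
Proof. by rewrite /reduced /=; case: w => //= y w /andP[]. Qed.

Lemma lcons_reduced x w : reduced w -> reduced (lcons x w).
Proof.
case: w => //= y w; case: ifPn => [_ /reduced_behead //|yx rw].
by rewrite /reduced /= yx.
Qed.

Lemma lconsE x w : reduced (x :: w) -> lcons x w = x :: w.
Proof. by rewrite /reduced; case: w => //= y w /andP[/negPf ->]. Qed.

Lemma lconsK x w : reduced w -> lcons x (lcons (linv x) w) = w.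
Proof.
case: w => [_|y w rw] /=; first by rewrite eqxx.
rewrite linvK; case: ifPn => [/eqP yx|yx] /=; last by rewrite eqxx.
by rewrite -yx lconsE.
Qed.

Definition lcat (u v : seq letter) : seq letter := foldr lcons v u.

Lemma lcat_reduced u v : reduced v -> reduced (lcat u v).
Proof. by move=> rv; elim: u => //= x u; apply: lcons_reduced. Qed.

Lemma lcat_lcons x u v :
  reduced u -> reduced v -> lcat (lcons x u) v = lcons x (lcat u v).
Proof.
move=> ru rv; case: u ru => //= y u ru; case: ifPn => [/eqP ->|//].
by rewrite lconsK// lcat_reduced.
Qed.

Lemma lcatA u v w : reduced u -> reduced v -> reduced w ->
  lcat u (lcat v w) = lcat (lcat u v) w.
Proof.
move=> ru rv rw; elim: u ru => //= x u IH rxu.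
by rewrite lcat_lcons ?lcat_reduced// IH ?(reduced_behead rxu).
Qed.

Lemma lcat0 u : reduced u -> lcat u [::] = u.
Proof.
by elim: u => //= x u IH rxu; rewrite IH ?(reduced_behead rxu)// lconsE.
Qed.

Definition winv (u : seq letter) : seq letter := rev (map linv u).

Lemma winv_reduced u : reduced u -> reduced (winv u).
Proof.
rewrite /reduced /winv rev_sorted sorted_map; apply: sub_sorted => x y /=.
by apply: contraNN => /eqP ->; rewrite linvK.
Qed.

Lemma lcat_cat u v w : lcat (u ++ v) w = lcat u (lcat v w).
Proof. by rewrite /lcat foldr_cat. Qed.

Lemma lcat_winvK u v : reduced v -> lcat (winv u) (lcat u v) = v.
Proof.
elim: u => //= x u IH rv.
rewrite /winv map_cons rev_cons -cats1 lcat_cat /=.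
by rewrite -{2}(linvK x) lconsK ?lcat_reduced// IH.
Qed.

Definition fg_mul (u v : free_group) : free_group :=
  FreeGroup (lcat_reduced u (valP v)).
Definition fg_one : free_group := @FreeGroup [::] isT.
Definition fg_inv (u : free_group) : free_group :=
  FreeGroup (winv_reduced (valP u)).

Lemma fg_mulA : associative fg_mul.
Proof.
by move=> u v w; apply/val_inj/lcatA; [exact: valP u|exact: valP v|exact: valP w].
Qed.

Lemma fg_mul1g : left_id fg_one fg_mul.
Proof. by move=> u; apply/val_inj. Qed.

Lemma fg_mulg1 : right_id fg_one fg_mul.
Proof. by move=> u; apply/val_inj/lcat0/valP. Qed.

Lemma fg_mulVg : left_inverse fg_one fg_inv fg_mul.
Proof.
move=> u; apply/val_inj => /=.
by rewrite -{2}[fg_word u](lcat0 (valP u)) lcat_winvK.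
Qed.

Lemma fg_invK : involutive fg_inv.
Proof.
move=> u; apply/val_inj => /=.
by rewrite /winv map_rev revK mapK//; exact: linvK.
Qed.

Lemma fg_mulgV : right_inverse fg_one fg_inv fg_mul.
Proof. by move=> u; rewrite -{1}(fg_invK u) fg_mulVg. Qed.

HB.instance Definition _ :=
  isGroup.Build free_group fg_mulA fg_mul1g fg_mulg1 fg_mulVg fg_mulgV.

End FreeGroup.

(* library norms over R[i] take values in the nonnegative reals of R[i] *)
Definition nrm (R : realType) (V : normedZmodType R[i]) (x : V) : R :=
  complex.Re `|x|.

HB.mixin Record Algebra_hasStar (R : realType) A & GRing.Algebra R[i] A := {
  star : A -> A;
  starK : involutive star;
  starD : {morph star : x y / x + y};
  starZ : forall (c : R[i]) x, star (c *: x) = c^* *: star x;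
  starM : forall x y, star (x * y) = star y * star x
}.

#[short(type="starAlgType")]
HB.structure Definition StarAlgebra (R : realType) :=
  {A of GRing.Algebra R[i] A & Algebra_hasStar R A}.

(* The norm is a field of its own, valued in R: the numeric and normed-module
   hierarchies of the libraries leave no room for a join of the algebra and
   normed-module structures. *)
HB.mixin Record StarAlgebra_isCstar (R : realType) A & StarAlgebra R A := {
  cnorm : A -> R;
  cnorm_eq0 : forall x, cnorm x = 0 -> x = 0;
  cnormD : forall x y, cnorm (x + y) <= cnorm x + cnorm y;
  cnormZ : forall (c : R[i]) x, cnorm (c *: x) = nrm c * cnorm x;
  cnormM : forall x y, cnorm (x * y) <= cnorm x * cnorm y;
  cnorm_star : forall x, cnorm (star x * x) = cnorm x ^+ 2;
  cnorm_complete : forall u : nat -> A,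
    (forall e, 0 < e -> exists N, forall m n, (N <= m)%N -> (N <= n)%N ->
       cnorm (u m - u n) < e) ->
    exists l, cnorm (u n - l) @[n --> \oo] --> (0 : R)
}.

(* A C*-algebra here is unital: its algebra structure has 1 != 0. *)
#[short(type="cstarAlgType")]
HB.structure Definition CstarAlgebra (R : realType) :=
  {A of StarAlgebra R A & StarAlgebra_isCstar R A}.

(* the inner product is linear in its first argument *)
HB.mixin Record NormedModule_hasDot (R : realType) V & NormedModule R[i] V := {
  dot : {dot V for Num.conj};
  sqr_norm_dot : forall x : V, `|x| ^+ 2 = dot x x
}.

#[short(type="hilbertType")]
HB.structure Definition Hilbert (R : realType) :=
  {V of CompleteNormedModule R[i] V & NormedModule_hasDot R V}.

Definition group_alg (R : realType) (G : groupType) : Type := {malg R[i][G]}.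

Section GroupAlgebra.
Variables (R : realType) (G : groupType).
Local Notation CG := (group_alg R G).
Implicit Types (f g h : CG) (s t : G) (c : R[i]).

HB.instance Definition _ := GRing.Lmodule.on CG.

Definition ga_one : CG := << 1%g >>.

Definition ga_mul f g : CG :=
  \sum_(s <- msupp f) \sum_(t <- msupp g) << f@_s * g@_t *g (s * t)%g >>.

Definition ga_star f : CG := \sum_(s <- msupp f) << (f@_s)^* *g s^-1%g >>.

Lemma ga_mullw (d1 d2 : {fset G}) f g :
  (msupp f `<=` d1)%fset -> (msupp g `<=` d2)%fset ->
  ga_mul f g = \sum_(s <- d1) \sum_(t <- d2) << f@_s * g@_t *g (s * t)%g >>.
Proof.
move=> le_d1 le_d2; rewrite /ga_mul (big_fset_incl _ le_d1) /=.
  apply/eq_bigr=> s _; apply/big_fset_incl => // t _ /mcoeff_outdom ->.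
  by rewrite mulr0 monalgU0.
move=> s _ /mcoeff_outdom fs.
by rewrite big1 => // t _; rewrite fs mul0r monalgU0.
Qed.

Lemma ga_mul0g : left_zero 0 ga_mul.
Proof. by move=> g; rewrite /ga_mul msupp0 big_seq_fset0. Qed.

Lemma ga_mulg0 : right_zero 0 ga_mul.
Proof.
by move=> g; rewrite /ga_mul; apply: big1 => s _; rewrite msupp0 big_seq_fset0.
Qed.

Lemma ga_mulUU c1 c2 s t :
  ga_mul << c1 *g s >> << c2 *g t >> = << c1 * c2 *g (s * t)%g >>.
Proof. by rewrite (ga_mullw msuppU_le msuppU_le) !big_seq_fset1 !mcoeffUU. Qed.

Lemma ga_mulDl : left_distributive ga_mul +%R.
Proof.
move=> f g h.
rewrite (@ga_mullw (msupp f `|` msupp g)%fset (msupp h) f h) ?fsubsetUl//.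
rewrite (@ga_mullw (msupp f `|` msupp g)%fset (msupp h) g h) ?fsubsetUr//.
rewrite (@ga_mullw (msupp f `|` msupp g)%fset (msupp h)) ?msuppD_le//.
rewrite -big_split /=; apply/eq_bigr=> s _.
rewrite -big_split /=; apply/eq_bigr=> t _.
by rewrite mcoeffD mulrDl monalgUD.
Qed.

Lemma ga_mulDr : right_distributive ga_mul +%R.
Proof.
move=> h f g.
rewrite (@ga_mullw (msupp h) (msupp f `|` msupp g)%fset h f) ?fsubsetUl//.
rewrite (@ga_mullw (msupp h) (msupp f `|` msupp g)%fset h g) ?fsubsetUr//.
rewrite (@ga_mullw (msupp h) (msupp f `|` msupp g)%fset) ?msuppD_le//.
rewrite -big_split /=; apply/eq_bigr=> s _.
rewrite -big_split /=; apply/eq_bigr=> t _.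
by rewrite mcoeffD mulrDr monalgUD.
Qed.

Lemma ga_mul_suml I (r : seq I) (F : I -> CG) g :
  ga_mul (\sum_(i <- r) F i) g = \sum_(i <- r) ga_mul (F i) g.
Proof.
exact: (big_morph (ga_mul^~ g) (fun _ _ => ga_mulDl _ _ _) (ga_mul0g _)).
Qed.

Lemma ga_mul_sumr I (r : seq I) (F : I -> CG) g :
  ga_mul g (\sum_(i <- r) F i) = \sum_(i <- r) ga_mul g (F i).
Proof.
exact: (big_morph (ga_mul g) (fun _ _ => ga_mulDr _ _ _) (ga_mulg0 _)).
Qed.

Lemma ga_ind (P : CG -> Prop) :
  (forall f g, P f -> P g -> P (f + g)) -> (forall c s, P << c *g s >>) ->
  forall f, P f.
Proof.
move=> PD PU f; rewrite (monalgE f); elim/big_rec: _ => [|s g _ Pg].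
  by rewrite -(monalgU0 (G := R[i]) (1%g : G)).
exact: PD.
Qed.

Lemma ga_mulA : associative ga_mul.
Proof.
move=> f g h; elim/ga_ind: f => [f f' Hf Hf'|c s].
  by rewrite !ga_mulDl Hf Hf'.
elim/ga_ind: g => [g g' Hg Hg'|c' t].
  by rewrite ga_mulDl !ga_mulDr ga_mulDl Hg Hg'.
elim/ga_ind: h => [h h' Hh Hh'|c'' u]; first by rewrite !ga_mulDr Hh Hh'.
by rewrite !ga_mulUU mulrA mulgA.
Qed.

Lemma ga_mul1g : left_id ga_one ga_mul.
Proof.
move=> f; elim/ga_ind: f => [f g Hf Hg|c s]; first by rewrite ga_mulDr Hf Hg.
by rewrite ga_mulUU mul1r mul1g.
Qed.

Lemma ga_mulg1 : right_id ga_one ga_mul.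
Proof.
move=> f; elim/ga_ind: f => [f g Hf Hg|c s]; first by rewrite ga_mulDl Hf Hg.
by rewrite ga_mulUU mulr1 mulg1.
Qed.

Lemma ga_one_neq0 : ga_one != 0.
Proof. by apply/eqP/malgP=> /(_ 1%g) /eqP; rewrite !mcoeffsE oner_eq0. Qed.

HB.instance Definition _ := GRing.Zmodule_isNzRing.Build CG
  ga_mulA ga_mul1g ga_mulg1 ga_mulDl ga_mulDr ga_one_neq0.

Lemma ga_scaleU c c' s : c *: (<< c' *g s >> : CG) = << c * c' *g s >>.
Proof.
by apply/malgP => t; rewrite mcoeffZ !mcoeffU mulrnAr.
Qed.

Lemma ga_scaleAl c f g : c *: (f * g) = (c *: f) * g.
Proof.
elim/ga_ind: f => [f f' Hf Hf'|c' s]; first by rewrite !(scalerDr, mulrDl) Hf Hf'.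
elim/ga_ind: g => [g g' Hg Hg'|c'' t]; first by rewrite !(scalerDr, mulrDr) Hg Hg'.
by rewrite ga_scaleU /GRing.mul/= !ga_mulUU ga_scaleU mulrA.
Qed.

HB.instance Definition _ := GRing.Lmodule_isLalgebra.Build R[i] CG ga_scaleAl.

Lemma ga_scaleAr c f g : c *: (f * g) = f * (c *: g).
Proof.
elim/ga_ind: f => [f f' Hf Hf'|c' s]; first by rewrite !(scalerDr, mulrDl) Hf Hf'.
elim/ga_ind: g => [g g' Hg Hg'|c'' t]; first by rewrite !(scalerDr, mulrDr) Hg Hg'.
by rewrite ga_scaleU /GRing.mul/= !ga_mulUU ga_scaleU mulrCA.
Qed.

HB.instance Definition _ := GRing.Lalgebra_isAlgebra.Build R[i] CG ga_scaleAr.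

Lemma ga_starE f t : (ga_star f)@_t = (f@_(t^-1%g))^*.
Proof.
rewrite /ga_star raddf_sum /= {3}(monalgE f) raddf_sum rmorph_sum /=.
by apply: eq_bigr => s _; rewrite !mcoeffU rmorphMn (can2_eq invgK invgK).
Qed.

Lemma ga_starK : involutive ga_star.
Proof. by move=> f; apply/malgP => t; rewrite !ga_starE invgK conjCK. Qed.

Lemma ga_starD : {morph ga_star : f g / f + g}.
Proof.
by move=> f g; apply/malgP => t; rewrite mcoeffD !ga_starE mcoeffD rmorphD.
Qed.

Lemma ga_starZ c f : ga_star (c *: f) = c^* *: ga_star f.
Proof.
by apply/malgP => t; rewrite mcoeffZ !ga_starE mcoeffZ rmorphM.
Qed.

Lemma ga_starU c s : ga_star << c *g s >> = << c^* *g s^-1%g >>.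
Proof.
apply/malgP => t; rewrite ga_starE !mcoeffU rmorphMn/=.
by congr (_ *+ (nat_of_bool _)); rewrite (can2_eq invgK invgK).
Qed.

Lemma ga_starM f g : ga_star (f * g) = ga_star g * ga_star f.
Proof.
elim/ga_ind: f => [f f' Hf Hf'|c s].
  by rewrite mulrDl !ga_starD mulrDr Hf Hf'.
elim/ga_ind: g => [g g' Hg Hg'|c' t].
  by rewrite mulrDr !ga_starD mulrDl Hg Hg'.
by rewrite /GRing.mul/= !ga_starU !ga_mulUU ga_starU rmorphM invgM mulrC.
Qed.

HB.instance Definition _ :=
  Algebra_hasStar.Build R CG ga_starK ga_starD ga_starZ ga_starM.

End GroupAlgebra.

Record unitary_rep (R : realType) (G : groupType) (H : hilbertType R) :=
  UnitaryRep {
    rep :> G -> {linear H -> H};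
    rep1 : forall x, rep 1%g x = x;
    repM : forall s t x, rep (s * t)%g x = rep s (rep t x);
    rep_dot : forall s x y, dot (rep s x) (rep s y) = dot x y
  }.

Definition rep_alg (R : realType) (G : groupType) (H : hilbertType R)
    (pi : unitary_rep G H) (f : group_alg R G) (x : H) : H :=
  \sum_(s <- msupp f) f@_s *: pi s x.

Definition rep_coef (R : realType) (G : groupType) (H : hilbertType R)
    (pi : unitary_rep G H) (x y : H) (s : G) : R[i] := dot (pi s x) y.

Definition ell (R : realType) (T : choiceType) (p : R) (f : T -> R[i]) : Prop :=
  summable [set: T] (fun s => (nrm (f s) `^ p)%:E).

Definition lp_rep (R : realType) (G : groupType) (H : hilbertType R) (p : R)
    (pi : unitary_rep G H) : Prop :=
  exists H0 : set H, [/\ GRing.submod_closed [in H0], dense H0 &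
    forall x y, H0 x -> H0 y -> ell p (rep_coef pi x y)].

Definition opnorm (R : realType) (V : normedZmodType R[i]) (T : V -> V) : R :=
  sup [set nrm (T x) | x in [set x | nrm x <= 1]].

(* the set is nonempty and bounded by the l_1-norm of f, so sup is the
   genuine supremum *)
Definition lp_norm (R : realType) (G : groupType) (p : R)
    (f : group_alg R G) : R :=
  sup [set r | exists (H : hilbertType R) (pi : unitary_rep G H),
         lp_rep p pi /\ r = opnorm (rep_alg pi f)].

Definition ell2_norm (R : realType) (T : choiceType) (xi : T -> R[i]) : R :=
  Num.sqrt (fine (\esum_(t in [set: T]) (nrm (xi t) ^+ 2)%:E)).

Definition lreg (R : realType) (G : groupType) (s : G) (xi : G -> R[i]) :
  G -> R[i] := fun t => xi (s^-1 * t)%g.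

Definition lreg_alg (R : realType) (G : groupType) (f : group_alg R G)
    (xi : G -> R[i]) : G -> R[i] :=
  fun t => \sum_(s <- msupp f) f@_s * lreg s xi t.

(* the norm of lambda(f) as an operator on l_2(G) *)
Definition reduced_norm (R : realType) (G : groupType)
    (f : group_alg R G) : R :=
  sup [set ell2_norm (lreg_alg f xi)
      | xi in [set xi : G -> R[i] | ell 2 xi /\ ell2_norm xi <= 1]].

Definition star_morph (R : realType) (A B : starAlgType R) (phi : A -> B) :=
  {morph phi : a / star a}.

(* A, with iota, is the C*-completion of the group algebra in the norm N; it is
   determined by N up to a unique isometric *-isomorphism compatible with the
   embeddings *)
Definition is_completion (R : realType) (G : groupType)
    (N : group_alg R G -> R) (A : cstarAlgType R)
    (iota : {lrmorphism group_alg R G -> A}) : Prop :=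
  [/\ star_morph iota,
      forall f, cnorm (iota f) = N f &
      forall (a : A) (e : R), 0 < e -> exists f, cnorm (a - iota f) < e].

Definition canonical_quotient (R : realType) (G : groupType)
    (A B : cstarAlgType R) (iA : {lrmorphism group_alg R G -> A})
    (iB : {lrmorphism group_alg R G -> B}) (phi : {lrmorphism A -> B}) : Prop :=
  [/\ star_morph phi, forall f, phi (iA f) = iB f &
      forall b, exists a, phi a = b].

Definition tracial_state (R : realType) (A : cstarAlgType R)
    (tau : A -> R[i]) : Prop :=
  [/\ scalar tau, tau 1 = 1, forall a, 0 <= tau (star a * a) &
      forall a b, tau (a * b) = tau (b * a)].

Definition unique_tracial_state (R : realType) (A : cstarAlgType R)
    (tau : A -> R[i]) : Prop :=
  tracial_state tau /\ forall tau', tracial_state tau' -> tau' = tau.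

(* Main.v *)
Require Import Defs.
From HB Require Import structures.
From mathcomp Require Import all_boot all_order all_algebra.
From mathcomp Require Import finmap complex monalg.
From mathcomp Require Import all_classical all_reals all_analysis.
From mathcomp Require Import ring lra.

(** A tracial state [sigma] on the l_p-completion is constant on conjugacy
  classes of the group. If [s <> 1] and [h 0, ..., h (n - 1)] are conjugates of
  [s], then [sigma s = sigma (n^-1 * sum_i h i)]. States are bounded
  ([positive_functional_bounded]), so it is enough to choose the conjugates with
  an average of arbitrarily small l_p-norm. This forces [sigma] to be the
  coefficient at 1 on the group algebra ([tracial_state_lp]), hence everywhere
  by density. Uniqueness on the reduced algebra follows by pulling traces back
  along the surjection [lambda_p], and existence because the coefficient at 1 is
  bounded by the reduced norm ([ga_tr_le_reduced], [trace_extend]).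

  The conjugates come from Powers' argument. The free group has a subset [D]
  and elements [t i] such that [s] maps the complement of [D] into [D] and the
  translates [t i * D] are disjoint ([free_powers_family]). With
  [h i = t i * s * (t i)^-1] the average of the [h i] then multiplies the
  l_2-norm on the group by at most [2 / sqrt n] ([sqsum_avg]).

  To pass from l_2 to l_p, let [A] be the average of the [h i] in an
  l_p-representation, [T = A^* A], and let [x] be in the dense subspace. The
  moment [<T ^ k x, x>] is at most the value at 1 of the [2 k]-fold average of
  the coefficient [s |-> |<x, pi s x>|] over the [h i] and their inverses. This
  coefficient is in l_p; its power of exponent [N = 2 ^ m], with [2 N >= p], is
  in l_2, and Jensen's inequality lets one raise the coefficient to that power
  inside the average. The l_2-contraction yields
  [<T ^ k x, x> ^ (2 N) <= C * (4 / n) ^ (2 k)], where [C] depends on [x]. The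
  constant disappears in the limit of large [k] ([moment_bound]), which leaves
  [|A x| <= (4 / n) ^ (1 / (2 N)) * |x|] on the dense subspace, hence everywhere
  ([lp_rep_avg_bound], [lp_norm_avg]). *)

Set Implicit Arguments.
Unset Strict Implicit.
Unset Printing Implicit Defensive.

Import Order.TTheory GRing.Theory Num.Theory.

Local Open Scope ring_scope.

(** * Real-valued norms and the Cauchy-Schwarz inequality *)

Section Nrm.
Variables (R : realType) (V : normedZmodType R[i]).
Implicit Types x y : V.

Lemma nrmE x : `|x| = (nrm x)%:C%C.
Proof. by rewrite /nrm RRe_real// ger0_real. Qed.

Lemma nrm_ge0 x : 0 <= nrm x.
Proof. by rewrite -ler0c -nrmE. Qed.

Lemma nrmD x y : nrm (x + y) <= nrm x + nrm y.
Proof. by rewrite -lecR rmorphD/= -!nrmE ler_normD. Qed.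

Lemma nrmN x : nrm (- x) = nrm x.
Proof. by rewrite /nrm normrN. Qed.

Lemma nrm0 : nrm (0 : V) = 0.
Proof. by rewrite /nrm normr0. Qed.

Lemma nrm_eq0 x : (nrm x == 0) = (x == 0).
Proof. by rewrite -(inj_eq (@complexI R)) -nrmE normr_eq0. Qed.

End Nrm.

Section NrmC.
Variable R : realType.
Implicit Types c : R[i].

Lemma nrmM c c' : nrm (c * c') = nrm c * nrm c'.
Proof. by apply: complexI; rewrite rmorphM/= -!nrmE normrM. Qed.

Lemma nrm_real (x : R) : nrm (x%:C%C) = `|x|.
Proof.
by rewrite /nrm normc_def/= expr0n/= addr0 sqrtr_sqr.
Qed.

Lemma nrmJ c : nrm c^* = nrm c.
Proof. by rewrite /nrm norm_conjC. Qed.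

Lemma nrm_nat n : nrm (n%:R : R[i]) = n%:R.
Proof. by rewrite -(rmorph_nat (real_complex R)) nrm_real ger0_norm. Qed.

Lemma nrm_natV n : nrm (n%:R^-1 : R[i]) = n%:R^-1.
Proof.
rewrite (_ : n%:R^-1 = (n%:R^-1 : R)%:C%C); last by rewrite fmorphV rmorph_nat.
by rewrite nrm_real ger0_norm ?invr_ge0.
Qed.

Lemma nrm_sqr c : nrm c ^+ 2 = complex.Re c ^+ 2 + complex.Im c ^+ 2.
Proof.
by rewrite /nrm normc_def/= sqr_sqrtr// addr_ge0// sqr_ge0.
Qed.

Lemma nrm_Re c : `|complex.Re c| <= nrm c.
Proof.
by rewrite -ler_sqr ?nnegrE ?nrm_ge0// nrm_sqr real_normK ?num_real// lerDl sqr_ge0.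
Qed.

Lemma nrm_Im c : `|complex.Im c| <= nrm c.
Proof.
by rewrite -ler_sqr ?nnegrE ?nrm_ge0// nrm_sqr real_normK ?num_real// lerDr sqr_ge0.
Qed.

Lemma nrm_le_ReIm c : nrm c <= `|complex.Re c| + `|complex.Im c|.
Proof.
rewrite -ler_sqr ?nnegrE ?nrm_ge0// ?addr_ge0// nrm_sqr sqrrD.
by rewrite !real_normK ?num_real// lerD2r lerDl mulrn_wge0// mulr_ge0.
Qed.

Lemma nrm_sum I (r : seq I) (F : I -> R[i]) :
  nrm (\sum_(i <- r) F i) <= \sum_(i <- r) nrm (F i).
Proof.
elim/big_ind2: _ => [|x x' y y' hx hy|//]; first by rewrite nrm0.
by apply: le_trans (nrmD _ _) _; apply: lerD.
Qed.

Lemma nrm_le_eps (K : R) (c : R[i]) : 0 <= K ->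
  (forall e : R, 0 < e -> nrm c <= K * e) -> c = 0.
Proof.
move=> K0 h; apply/eqP; rewrite -nrm_eq0 eq_le nrm_ge0 andbT.
apply/ler_addgt0Pl => e e0; rewrite addr0.
apply: le_trans (h (e / (K + 1)) _) _; first by rewrite divr_gt0// ltr_wpDl.
rewrite mulrCA ler_piMr ?(ltW e0)// ler_pdivrMr ?ltr_wpDl// mul1r lerDl//.
Qed.

End NrmC.

Section Hilbert.
Variables (R : realType) (H : hilbertType R).
Implicit Types x y z : H.

Lemma nrm_dot x : (nrm x ^+ 2)%:C%C = dot x x.
Proof. by rewrite rmorphXn/= -nrmE sqr_norm_dot. Qed.

Lemma nrmZ (c : R[i]) x : nrm (c *: x) = nrm c * nrm x.
Proof. by apply: complexI; rewrite rmorphM/= -!nrmE normrZ. Qed.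

Lemma dotC x y : dot x y = (dot y x)^*.
Proof. by rewrite hermC expr0 mul1r. Qed.

Lemma dotDl x y z : dot (x + y) z = dot x z + dot y z.
Proof. exact: linearDl. Qed.

Lemma dotZl (c : R[i]) x z : dot (c *: x) z = c * dot x z.
Proof. exact: linearZl_LR. Qed.

Lemma dotDr x y z : dot z (x + y) = dot z x + dot z y.
Proof. exact: linearDr. Qed.

Lemma dotZr (c : R[i]) x z : dot z (c *: x) = c^* * dot z x.
Proof. exact: linearZr_LR. Qed.

Lemma dot0l z : dot 0 z = 0.
Proof. exact: linear0l. Qed.

Lemma dot0r z : dot z 0 = 0.
Proof. by rewrite dotC dot0l rmorph0. Qed.

Lemma dot_suml I (r : seq I) (F : I -> H) z :
  dot (\sum_(i <- r) F i) z = \sum_(i <- r) dot (F i) z.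
Proof. exact: (big_morph (fun x => dot x z) (fun x y => dotDl x y z) (dot0l z)). Qed.

Lemma dot_sumr I (r : seq I) (F : I -> H) z :
  dot z (\sum_(i <- r) F i) = \sum_(i <- r) dot z (F i).
Proof. exact: (big_morph (dot z) (fun x y => dotDr x y z) (dot0r z)). Qed.

Lemma dot_Cauchy_Schwarz x y : nrm (dot x y) <= nrm x * nrm y.
Proof.
have [->|y0] := eqVneq y 0; first by rewrite dot0r !nrm0 mulr0.
have yy : 0 < nrm y by rewrite lt_def nrm_eq0 y0 nrm_ge0.
rewrite -ler_sqr ?nnegrE ?mulr_ge0 ?nrm_ge0//.
(* z is the component of x orthogonal to y, scaled to avoid dividing *)
pose z := dot y y *: x - dot x y *: y.
have : (nrm z ^+ 2)%:C%C =
    (nrm y ^+ 2 * ((nrm x * nrm y) ^+ 2 - nrm (dot x y) ^+ 2))%:C%C.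
  rewrite nrm_dot /z -scaleNr dotDl !dotDr !dotZl !dotZr (dotC y x) rmorphN/=.
  have rJ (r : R) : (r%:C%C : R[i])^* = r%:C%C by rewrite conj_Creal// complex_real.
  rewrite -!nrm_dot !rJ exprMn.
  rewrite (rmorphM (real_complex R) _ (_ - _)) (rmorphB (real_complex R)).
  rewrite (rmorphM (real_complex R) (nrm x ^+ 2)) (rmorphXn (real_complex R) 2 (nrm (dot x y))).
  rewrite /= -nrmE normCK.
  set a := dot x y; set b := a^*; set u := (_ ^+ 2)%:C%C; set v := (_ ^+ 2)%:C%C.
  by ring.
move=> /complexI e; have := sqr_ge0 (nrm z).
by rewrite e pmulr_rge0 ?exprn_gt0// subr_ge0.
Qed.

End Hilbert.

(** * Positive functionals on C*-algebras are bounded *)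

Section Star.
Variables (R : realType) (A : starAlgType R).
Implicit Types x y : A.

Lemma star1 : star (1 : A) = 1.
Proof. by rewrite -[LHS]mulr1 -[X in _ * X]starK -starM mulr1 starK. Qed.

Lemma starN x : star (- x) = - star x.
Proof. by rewrite -[in LHS]scaleN1r starZ rmorphN rmorph1 scaleN1r. Qed.

Lemma star0 : star (0 : A) = 0.
Proof. by rewrite -[X in star X](scale0r (0 : A)) starZ rmorph0 scale0r. Qed.

Lemma starB x y : star (x - y) = star x - star y.
Proof. by rewrite starD starN. Qed.

End Star.

Section Cnorm.
Variables (R : realType) (A : cstarAlgType R).
Implicit Types x y a : A.

Lemma cnorm0 : cnorm (0 : A) = 0.
Proof. by rewrite -[X in cnorm X](scale0r (0 : A)) cnormZ nrm0 mul0r. Qed.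

Lemma cnormN x : cnorm (- x) = cnorm x.
Proof. by rewrite -scaleN1r cnormZ nrmN (nrm_nat _ 1) mul1r. Qed.

Lemma cnorm_ge0 x : 0 <= cnorm x.
Proof.
have := cnormD x (- x); rewrite subrr cnorm0 cnormN => ?; lra.
Qed.

Lemma cnormB x y : cnorm (x - y) = cnorm (y - x).
Proof. by rewrite -opprB cnormN. Qed.

Lemma cnorm_triangle y x z : cnorm (x - z) <= cnorm (x - y) + cnorm (y - z).
Proof. by rewrite -[x - z](subrKA y) cnormD. Qed.

Lemma cnorm_starE x : cnorm (star x) = cnorm x.
Proof.
have le y : cnorm y <= cnorm (star y).
  have [->|y0] := eqVneq (cnorm y) 0; first exact: cnorm_ge0.
  have y1 : 0 < cnorm y by rewrite lt_def y0 cnorm_ge0.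
  by rewrite -(ler_pM2r y1) -expr2 -cnorm_star cnormM.
by apply/eqP; rewrite eq_le le andbT -{2}(starK x) le.
Qed.

Lemma cnorm_le_eps x : (forall e : R, 0 < e -> cnorm x <= e) -> x = 0.
Proof.
move=> h; apply: (@cnorm_eq0 R); apply/eqP; rewrite eq_le cnorm_ge0 andbT.
by apply/ler_addgt0Pl => e /h; rewrite addr0.
Qed.

(** With [b = 1 - y] the equation [b * b = 1 - x] reads [y = (x + y * y) / 2],
  and the right-hand side contracts the ball of radius 1/2 when the norm of
  [x] is at most 1/4. An elementary fixed point thus does the work of the
  functional calculus. *)
Lemma sqrt_1Bx x : star x = x -> cnorm x <= 4^-1 ->
  exists2 b, star b = b & b * b = 1 - x.
Proof.
move=> sx x4.
pose F (y : A) := 2^-1 *: (x + y * y).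
have n2 : nrm (2^-1 : R[i]) = 2^-1 := nrm_natV R 2.
have FB y z : cnorm y <= 2^-1 -> cnorm z <= 2^-1 ->
    cnorm (F y - F z) <= 2^-1 * cnorm (y - z).
  move=> y2 z2; rewrite /F -scalerBr cnormZ n2 ler_wpM2l ?invr_ge0//.
  have -> : x + y * y - (x + z * z) = y * (y - z) + (y - z) * z.
    by rewrite mulrBr mulrBl addrA subrK opprD addrACA subrr add0r.
  apply: le_trans (cnormD _ _) _.
  apply: le_trans (lerD (cnormM _ _) (cnormM _ _)) _.
  have := cnorm_ge0 (y - z); nra.
pose y n := iter n F 0.
have y2 n : cnorm (y n) <= 2^-1.
  elim: n => [|n IH]; first by rewrite cnorm0 invr_ge0.
  rewrite /= cnormZ n2.
  have := cnormD x (y n * y n); have := cnormM (y n) (y n).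
  have := cnorm_ge0 (y n); rewrite -/(y n) => *; nra.
have sy n : star (y n) = y n.
  elim: n => [|n IH] /=; first exact: star0.
  rewrite starZ starD starM IH sx; congr (_ *: _).
  by rewrite conj_Creal// realV realn.
have yB n k : cnorm (y (n + k)%N - y n) <= 2^-1 ^+ n.
  elim: n => [|n IH]; first by rewrite subr0 expr0 (le_trans (y2 _))//; lra.
  by rewrite addSn exprS; apply: le_trans (FB _ _ (y2 _) (y2 _)) _;
     rewrite ler_wpM2l ?invr_ge0.
have small (e : R) : 0 < e -> exists n, 2^-1 ^+ n < e.
  move=> e0; pose n := Num.truncn e^-1; exists n.+1.
  rewrite exprVn invf_plt ?posrE ?exprn_gt0//.
  apply: (@lt_le_trans _ _ n.+1%:R); first by rewrite truncnS_gt.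
  by rewrite -natrX ler_nat ltnW// ltn_expl.
have [|l yl] := @cnorm_complete R A y.
  move=> e e0; have e2 : 0 < e / 2 := divr_gt0 e0 (ltr0n _ 2); have [N Ne] := small _ e2.
  exists N => m n Nm Nn; rewrite -(subnKC Nm) -(subnKC Nn).
  apply: le_lt_trans (cnorm_triangle (y N) _ _) _.
  rewrite [X in _ + X]cnormB.
  have := yB N (m - N)%N; have := yB N (n - N)%N; lra.
have yle (e : R) : 0 < e -> exists n, cnorm (y n - l) < e /\ cnorm (y n.+1 - l) < e.
  move=> e0; have /cvgrPdist_lt /(_ e e0) [N _ hN] := yl.
  exists N; split.
    by have := hN N (leqnn _); rewrite /= sub0r normrN ger0_norm ?cnorm_ge0.
  by have := hN N.+1 (leqnSn _); rewrite /= sub0r normrN ger0_norm ?cnorm_ge0.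
have sl : star l = l.
  apply/eqP; rewrite -subr_eq0; apply/eqP/cnorm_le_eps => e e0.
  have [n [h _]] := yle (e / 2) (divr_gt0 e0 (ltr0n _ 2)).
  apply: le_trans (cnorm_triangle (y n) _ _) _.
  by rewrite -{1}(sy n) -starB cnorm_starE [X in X + _]cnormB; lra.
have l2 : cnorm l <= 2^-1.
  apply/ler_addgt0Pr => e /yle[n [h _]].
  have := cnorm_triangle (y n) l 0; rewrite !subr0 cnormB; have := y2 n; lra.
have Fl : F l = l.
  apply/eqP; rewrite -subr_eq0; apply/eqP/cnorm_le_eps => e e0.
  have [n [h1 h2]] := yle (e / 2) (divr_gt0 e0 (ltr0n _ 2)).
  apply: le_trans (cnorm_triangle (y n.+1) _ _) _.
  have := FB _ _ l2 (y2 n); rewrite [X in _ <= _ * X]cnormB /= -/(y n).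
  have := cnorm_ge0 (y n - l); lra.
exists (1 - l); first by rewrite starB star1 sl.
rewrite mulrBl mul1r mulrBr mulr1.
have : l + l = x + l * l.
  by rewrite -{1 2}Fl /F -scalerDl -mulr2n -(mulr_natr 2^-1) mulVf ?pnatr_eq0// scale1r.
move=> /(canLR (addrK _)) <-.
by rewrite !opprD !opprK !addrA.
Qed.

(** A self-adjoint [x] of norm at most 1/4 makes both [1 - x] and [1 + x] squares
  of self-adjoint elements, so positivity puts [f x] in [[-1, 1]]; a general
  element is split into its real and imaginary parts. The sharp constant is 1,
  but any constant gives continuity, and only continuity matters below. *)
Lemma positive_functional_bounded (f : A -> R[i]) :
  scalar f -> f 1 = 1 -> (forall a, 0 <= f (star a * a)) ->
  forall a, nrm (f a) <= 8 * cnorm a.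
Proof.
move=> fl f1 fp.
pose fL := GRing.isLinear.Build _ _ _ _ f fl.
pose g : {scalar A} := HB.pack f fL.
have fB x y : f (x - y) = f x - f y := raddfB g x y.
have fD x y : f (x + y) = f x + f y := raddfD g x y.
have fZ (c : R[i]) x : f (c *: x) = c * f x := linearZ_LR g c x.
have fN x : f (- x) = - f x := raddfN g x.
have sa x : star x = x -> cnorm x <= 4^-1 -> nrm (f x) <= 1.
  move=> sx x4.
  have le1 y : star y = y -> cnorm y <= 4^-1 -> f y <= 1.
    move=> sy y4; have [b sb bb] := sqrt_1Bx sy y4.
    by rewrite -subr_ge0 -f1 -fB -bb -{1}sb fp.
  have h1 := le1 _ sx x4.
  have h2 : - f x <= 1 by rewrite -fN le1 ?starN ?sx ?cnormN.
  have := h1; have := h2; rewrite !lecE /= => /andP[/eqP im re2] /andP[_ re1].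
  apply: le_trans (nrm_le_ReIm _) _.
  move: im re1 re2; case: (f x) => u v /= ? ? ?.
  have -> : v = 0 by lra.
  by rewrite normr0 addr0 ler_norml; apply/andP; split; lra.
have small a : cnorm a <= 4^-1 -> nrm (f a) <= 2.
  move=> a4.
  pose h : R[i] := 2^-1; pose x := h *: (a + star a).
  pose y := (h * 'i) *: (star a - a).
  have hJ : h^* = h by rewrite /h conj_Creal// realV realn.
  have hn : nrm h = 2^-1 := nrm_natV R 2.
  have in1 : nrm ('i : R[i]) = 1 by rewrite /nrm normCi.
  have sx : star x = x by rewrite starZ starD starK hJ addrC.
  have sy : star y = y.
    by rewrite starZ starB starK rmorphM /= hJ conjCi mulrN scaleNr -scalerN opprB.
  have -> : a = x + 'i *: (y : A).
    rewrite /x /y scalerA mulrCA -expr2 sqrCi mulrN1 scaleNr -scalerN opprB.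
    rewrite -scalerDr addrACA subrr addr0 -mulr2n.
    by rewrite -scaler_nat scalerA /h mulVf ?pnatr_eq0// scale1r.
  have nx : cnorm x <= 4^-1.
    rewrite cnormZ hn; have := cnormD a (star a); rewrite cnorm_starE; lra.
  have ny : cnorm y <= 4^-1.
    rewrite cnormZ nrmM hn in1.
    have := cnormD (star a) (- a); rewrite cnormN cnorm_starE; lra.
  rewrite fD (fZ 'i y); apply: le_trans (nrmD _ _) _; rewrite nrmM in1 mul1r.
  by have := sa _ sx nx; have := sa _ sy ny; lra.
move=> a; have [->|a0] := eqVneq a 0.
  by rewrite (_ : f 0 = 0) ?nrm0 ?mulr_ge0 ?cnorm_ge0//; exact: (raddf0 g).
have n0 : 0 < cnorm a.
  rewrite lt_def cnorm_ge0 andbT; apply: contra a0 => /eqP h.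
  by apply/eqP/cnorm_eq0.
pose c : R := (4 * cnorm a)^-1.
have c0 : 0 < c by rewrite invr_gt0 mulr_gt0.
have := small (c%:C%C *: a); rewrite cnormZ nrm_real (gtr0_norm c0).
have -> : c * cnorm a = 4^-1 by rewrite /c; field; rewrite gt_eqF.
move=> /(_ (lexx _)); rewrite fZ nrmM nrm_real (gtr0_norm c0).
rewrite /c mulrC ler_pdivrMr ?mulr_gt0//; lra.
Qed.

End Cnorm.

(** * Paradoxical translates in the free group *)

(** Powers' ping-pong configuration: with [C] the complement of [D], the element
  [s] maps [C] into [D], and the translates [t i * D] are pairwise disjoint. *)
Definition powers_family (G : groupType) (s : G) (t : nat -> G) (D : pred G) :=
  (forall u, D u || D (s * u)%g) /\
  (forall i j u, D ((t i)^-1 * u)%g -> D ((t j)^-1 * u)%g -> i = j).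

Lemma powers_familyV (G : groupType) (s : G) t D :
  powers_family s t D -> powers_family s^-1%g t D.
Proof.
move=> [sD tD]; split=> // u.
by have := sD (s^-1 * u)%g; rewrite mulVKg orbC.
Qed.

Section FreePowers.
Variable d : nat.
Implicit Types (x y z : letter d) (u v w : seq (letter d)).

Lemma linv_neq x : linv x != x.
Proof. by case: x => i [] /=; rewrite xpair_eqE eqxx. Qed.

Lemma lcat_concat u v : reduced (u ++ v) -> lcat u v = u ++ v.
Proof.
elim: u => //= x u IH rxuv.
by rewrite IH ?(reduced_behead rxuv)// lconsE.
Qed.

Lemma reduced_cat_cons x p z w : reduced (x :: p) -> reduced (z :: w) ->
  z != linv (last x p) -> reduced ((x :: p) ++ z :: w).
Proof. by rewrite /reduced /= cat_path /= => -> -> ->. Qed.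

(** Let [C] be the set of reduced words that start with a letter [z], chosen
  different from the first letter of [s] and from the inverse of its last
  letter. No cancellation occurs between [s] and a word of [C], and the product
  starts with the first letter of [s], so it lies outside [C]. With
  [y] different from [z] and its inverse and [t i = y ^ i * z^-1], no
  cancellation occurs between [t i] and a word outside [C] either, and [i] is
  recovered from the product as the number of leading letters [y]. *)
Lemma free_powers_family (s : free_group d) : (2 <= d)%N -> s != 1%g ->
  exists t D, powers_family s t D.
Proof.
move=> d2 s1.
have avoid a b : exists z, (z != a) && (z != b).
  have : (2 < #|{: letter d}|)%N.
    by rewrite card_prod card_ord card_bool; case: d d2 => [|[|[|]]].
  apply: contraPP => /forallNP h; apply/negP; rewrite -leqNgt.
  apply: leq_trans (card_size [:: a; b]).
  apply/subset_leq_card/fintype.subsetP => z _; rewrite !inE.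
  by apply/negPn; rewrite negb_or; apply/negP/h.
have [x [p sE]] : exists x p, fg_word s = x :: p.
  case: s s1 => -[|x p] r; last by exists x, p.
  by move=> /eqP[]; exact/val_inj.
have rs : reduced (x :: p) by rewrite -sE; exact: (valP s).
have [z /andP[zx zl]] := avoid x (linv (last x p)).
have [y /andP[yz yz']] := avoid z (linv z).
have rt i : reduced (nseq i y ++ [:: linv z]).
  rewrite /reduced; case: i => //= i.
  have zy : linv z != linv y by rewrite (inj_eq (can_inj (@linvK d))) eq_sym.
  by elim: i => [|i IH] /=; rewrite ?zy// eq_sym linv_neq.
pose t i : free_group d := FreeGroup (rt i).
pose D (u : free_group d) := ohead (fg_word u) != Some z.
exists t, D; split=> [u|i j u].
  rewrite /D /=; case uE: (fg_word u) => [|a w] //=.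
  case: eqVneq => //= -[az]; rewrite az in uE *.
  have ru : reduced (z :: w) by rewrite -uE; exact: (valP u).
  rewrite sE lcat_concat; first by apply/eqP => -[/esym/eqP]; rewrite (negPf zx).
  exact: reduced_cat_cons.
have tE k (v : free_group d) : D v ->
    fg_word (t k * v)%g = nseq k y ++ linv z :: fg_word v.
  case: v => w rw; rewrite /D /= => wz.
  rewrite [RHS](catA _ [:: _]) -[RHS]lcat_concat//.   case: w rw wz => [_ _|a w rw /= az]; first by rewrite cats0.
  have {az} az : a != linv (linv z) by rewrite linvK.
  by have := rt k; case: k => [_|k];
     [exact: (@reduced_cat_cons (linv z) [::]) | move=> rk;
      apply: (@reduced_cat_cons y (nseq k y ++ _)); rewrite ?last_cat].
have key k : D ((t k)^-1 * u)%g -> find (predC1 y) (fg_word u) = k.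
  move=> /tE tv; have uE : u = (t k * ((t k)^-1 * u))%g by rewrite mulVKg.
  rewrite [in LHS]uE tv.
  rewrite find_cat has_nseq /= eqxx andbF size_nseq.
  by rewrite eq_sym yz' /= addn0.
by move=> /key <- /key <-.
Qed.

End FreePowers.

(** * Averages of translations on square-summable functions *)

Section Esum.
Variables (R : realType) (T : choiceType).
Local Open Scope ereal_scope.

Lemma esumZ_le (k : R) (a : T -> \bar R) : (0 <= k)%R -> (forall t, 0 <= a t) ->
  \esum_(t in [set: T]%classic) (k%:E * a t) <= k%:E * \esum_(t in [set: T]%classic) a t.
Proof.
move=> k0 a0; rewrite ge_ereal_sup => //= _ [X [finX XI]] <-.
rewrite -ge0_mule_fsumr//; apply: lee_wpmul2l; rewrite ?lee_fin//.
by rewrite ereal_sup_ubound//=; exists X.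
Qed.

Lemma le_esumT (a : T -> \bar R) t : (forall t, 0 <= a t) ->
  a t <= \esum_(t in [set: T]%classic) a t.
Proof.
move=> a0; apply: esum_ge; exists [set t]%classic; first by split => //; exact: finite_set1.
by rewrite fsbig_set1.
Qed.

End Esum.

Lemma sqr_sum_le (R : realFieldType) I (r : seq I) (b : I -> R) :
  (\sum_(i <- r) b i) ^+ 2 <= (size r)%:R * \sum_(i <- r) b i ^+ 2.
Proof.
have [r0|n0] := eqVneq (size r) 0%N.
  by rewrite (size0nil r0) !big_nil mulr0 expr0n.
have n1 : 0 < (size r)%:R :> R by rewrite ltr0n lt0n.
(* expanding the sum of the squared deviations from the mean m *)
pose m := (size r)%:R^-1 * \sum_(i <- r) b i.
have mE : \sum_(i <- r) b i = (size r)%:R * m.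
  by rewrite /m mulrA mulfV ?mul1r// gt_eqF.
have : 0 <= \sum_(i <- r) (b i - m) ^+ 2 by apply: sumr_ge0 => i _; exact: sqr_ge0.
under eq_bigr do rewrite sqrrB.
rewrite big_split sumrB /= big_const_seq count_predT iter_addr_0.
rewrite sumrMnl -mulr_suml mE -(mulr_natl (m ^+ 2)) -(mulr_natl (_ * m)).
set Q := \sum_(i <- r) _ => h; rewrite exprMn expr2 -mulrA ler_pM2l// -subr_ge0.
by apply: (le_trans h); rewrite le_eqVlt; apply/orP; left; apply/eqP; ring.
Qed.

Lemma jensen_sqr (R : realFieldType) n (b : nat -> R) :
  (n%:R^-1 * \sum_(i < n) b i) ^+ 2 <= n%:R^-1 * \sum_(i < n) b i ^+ 2.
Proof.
have [->|n0] := eqVneq n 0; first by rewrite !big_ord0 !mulr0 expr0n.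
have n1 : 0 < n%:R :> R by rewrite ltr0n lt0n.
have := sqr_sum_le (enum 'I_n) (fun i : 'I_n => b i).
rewrite !big_enum size_enum_ord exprMn expr2 -mulrA ler_pM2l ?invr_gt0//.
by rewrite ler_pdivrMl.
Qed.

Section Average.
Variables (R : realType) (G : groupType).
Implicit Types (f : G -> R) (h : nat -> G).

Definition avg n h f : G -> R :=
  fun x => n%:R^-1 * \sum_(i < n) f ((h i)^-1 * x)%g.

Definition sqsum f : \bar R := \esum_(x in [set: G]%classic) (f x ^+ 2)%:E.

Lemma sqsum_ge0 f : (0 <= sqsum f)%E.
Proof. by apply: esum_ge0 => x _; rewrite lee_fin sqr_ge0. Qed.

Lemma esum_translate (g : G) (a : G -> \bar R) :
  \esum_(x in [set: G]%classic) a (g * x)%g = \esum_(x in [set: G]%classic) a x.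
Proof.
apply/esym/(reindex_esum [set: G]%classic [set: G]%classic (fun x => g * x)%g); split => //.
  by move=> x y _ _ /mulgI.
by move=> y _; exists (g^-1 * y)%g; rewrite ?mulVKg.
Qed.

Definition conjugates (t : nat -> G) (s : G) i := (t i * s * (t i)^-1)%g.

(** Split the sum at [x] according to whether [x] is in [t i * D]. This happens
  for at most one [i], so those terms contribute a sum of squares with no cross
  terms. For the others [h i] has carried a point of [t i * D] to [x], because
  it maps the complement of [t i * D] into [t i * D]; Jensen's inequality
  bounds them, and the restriction to [t i * D] is kept for the summation over
  [x], where it makes up for the loss in Jensen's inequality. *)
Lemma avg_sqr_le n s t D f x (h := conjugates t s) : powers_family s t D ->
  avg n h f x ^+ 2 <=
    2 / n%:R ^+ 2 * (\sum_(i < n) f ((h i)^-1 * x)%g ^+ 2) +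
    2 / n%:R * \sum_(i < n)
      (if D ((t i)^-1 * ((h i)^-1 * x))%g then f ((h i)^-1 * x)%g ^+ 2 else 0).
Proof.
move=> [sD tD]; pose a i := f ((h i)^-1 * x)%g.
pose c i := if D ((t i)^-1 * x)%g then a i else 0.
pose b i := if D ((t i)^-1 * x)%g then 0 else a i.
have -> : avg n h f x = n%:R^-1 * \sum_(i < n) c i + n%:R^-1 * \sum_(i < n) b i.
  rewrite -mulrDr -big_split; congr (_ * _); apply: eq_bigr => i _ /=.
  by rewrite /c /b -/(a i); case: ifP; rewrite (addr0, add0r).
have cle : (\sum_(i < n) c i) ^+ 2 <= \sum_(i < n) a i ^+ 2.
  have [[i0 Di0]|nD] := pselect (exists i : 'I_n, D ((t i)^-1 * x)%g); last first.
    rewrite big1 ?expr0n/= ?sumr_ge0// => [i _|i _]; first exact: sqr_ge0.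
    by rewrite /c; case: ifP => // Di; case: nD; exists i.
  rewrite (bigD1 i0)//= big1 ?addr0 => [|i ii0]; last first.
    rewrite /c; case: ifP => // Di; move/eqP: ii0; case.
    by apply/val_inj/(tD _ _ x).
  by rewrite (bigD1 i0)//= /c Di0 lerDl sumr_ge0// => i _; exact: sqr_ge0.
have ble : \sum_(i < n) b i ^+ 2 <=
    \sum_(i < n) (if D ((t i)^-1 * ((h i)^-1 * x))%g then a i ^+ 2 else 0).
  apply: ler_sum => i _; rewrite /b; case: ifPn => [_|nDx].
    by rewrite expr0n/=; case: ifP => // _; exact: sqr_ge0.
  have := sD ((t i)^-1 * ((h i)^-1 * x))%g.
  rewrite (_ : s * _ = (t i)^-1 * x)%g ?(negPf nDx) ?orbF => [->//|].
  by rewrite /h /conjugates !invgM invgK !mulgA mulgVK mulgV mul1g.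
have jen := jensen_sqr n b.
set u := _ * \sum_(i < n) c i; set v := _ * \sum_(i < n) b i in jen *.
have n0 : 0 <= n%:R^-1 :> R by rewrite invr_ge0.
have u2 : u ^+ 2 <= n%:R^-1 ^+ 2 * \sum_(i < n) a i ^+ 2.
  by rewrite exprMn ler_wpM2l ?sqr_ge0.
have v2 : v ^+ 2 <= n%:R^-1 * \sum_(i < n)
    (if D ((t i)^-1 * ((h i)^-1 * x))%g then a i ^+ 2 else 0).
  by apply: le_trans jen _; rewrite ler_wpM2l.
have uv : (u + v) ^+ 2 <= 2 * u ^+ 2 + 2 * v ^+ 2.
  by have := sqr_ge0 (u - v); nra.
apply: le_trans uv _; rewrite -!mulrA -exprVn; apply: lerD; exact: ler_wpM2l.
Qed.

(** Summing over [x] in the preceding lemma, both terms give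
  [2 / n * sqsum f]: the first because it is a sum of [n] translates of [f ^ 2],
  the second because the sets [t i * D] are disjoint. *)
Lemma sqsum_avg n s t D f : (0 < n)%N -> powers_family s t D ->
  (sqsum (avg n (conjugates t s) f) <= (4 / n%:R)%:E * sqsum f)%E.
Proof.
move=> n0 pf; set h := conjugates _ _.
have n1 : 0 < n%:R :> R by rewrite ltr0n.
have sq y : (0 <= (f y ^+ 2)%:E)%E by rewrite lee_fin sqr_ge0.
pose k1 : R := 2 / n%:R ^+ 2; pose k2 : R := 2 / n%:R.
have k10 : 0 <= k1 by rewrite divr_ge0// exprn_ge0.
have k20 : 0 <= k2 by rewrite divr_ge0.
pose F1 x := (\sum_(i < n) (f ((h i)^-1 * x)%g ^+ 2)%:E)%E.
pose g i y : \bar R := if D ((t i)^-1 * y)%g then (f y ^+ 2)%:E else 0%E.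
have g0 i y : (0 <= g i y)%E by rewrite /g; case: ifP.
pose F2 x := (\sum_(i < n) g i ((h i)^-1 * x)%g)%E.
have F10 x : (0 <= F1 x)%E by apply: sume_ge0.
have F20 x : (0 <= F2 x)%E by apply: sume_ge0.
have S1 : (\esum_(x in [set: G]%classic) F1 x = n%:R%:E * sqsum f)%E.
  rewrite esum_sum//.
  under eq_bigr do rewrite (esum_translate _ (fun y => (f y ^+ 2)%:E)) -[esum _ _]mul1e.
  by rewrite -ge0_sume_distrl// sumEFin sumr_const card_ord.
have S2 : (\esum_(x in [set: G]%classic) F2 x <= sqsum f)%E.
  rewrite esum_sum//.
  under eq_bigr => i _ do rewrite (esum_translate _ (g i)).
  rewrite -esum_sum//; apply: le_esum => y _; rewrite /g.
  have [[i0 Di0]|nD] := pselect (exists i : 'I_n, D ((t i)^-1 * y)%g); last first.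
    rewrite big1// => i _; case: ifP => // Di; case: nD; exists i; exact: Di.
  rewrite (bigD1 i0)//= Di0 big1 ?adde0// => i ii0; case: ifP => // Di.
  by move/eqP: ii0; case; apply/val_inj/(pf.2 _ _ y).
apply: (@le_trans _ _ (\esum_(x in [set: G]%classic) (k1%:E * F1 x + k2%:E * F2 x))%E).
  apply: le_esum => x _.
  have -> : F2 x = (\sum_(i < n)
      (if D ((t i)^-1 * ((h i)^-1 * x))%g then f ((h i)^-1 * x)%g ^+ 2 else 0))%:E.
    by rewrite -sumEFin; apply: eq_bigr => i _; rewrite /g; case: ifP.
  by rewrite /F1 sumEFin -!EFinM -EFinD lee_fin avg_sqr_le.
rewrite esumD; last 2 first.
- by move=> x _; rewrite mule_ge0.
- by move=> x _; rewrite mule_ge0.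
apply: (@le_trans _ _ (k1%:E * (n%:R%:E * sqsum f) + k2%:E * sqsum f)%E).
  apply: leeD; first by rewrite -S1; exact: esumZ_le.
  apply: le_trans (esumZ_le _ _) _ => //.
  by apply: lee_wpmul2l; rewrite ?lee_fin.
rewrite muleA -EFinM -ge0_muleDl ?lee_fin ?mulr_ge0// -EFinD.
rewrite (_ : k1 * n%:R + k2 = 4 / n%:R)// /k1 /k2.
by field; rewrite gt_eqF.
Qed.

End Average.

(** * Averages of conjugates in l_p-representations *)

Lemma bernoulli_le (R : realDomainType) (x : R) n : 0 <= x -> 1 + x *+ n <= (1 + x) ^+ n.
Proof.
move=> x0; elim: n => [|n IH]; first by rewrite mulr0n addr0 expr0.
rewrite exprSr; apply: (@le_trans _ _ ((1 + x *+ n) * (1 + x))).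
  have := mulr_ge0 (mulrn_wge0 n x0) x0; rewrite mulrS; lra.
by rewrite ler_wpM2r// addr_ge0.
Qed.

(** Along the powers of 2 the hypothesis on squares iterates to
  [(a 1 / a 0) ^ (2 ^ j) <= a (2 ^ j) / a 0], so an exponential bound on [a]
  passes to the ratio [a 1 / a 0] with its constant [C] washed out. In the
  application [a] lists the moments of a positive operator at a vector, and
  this is the spectral radius formula. *)
Lemma moment_bound (R : realType) (a : nat -> R) (r C : R) Q :
  (0 < Q)%N -> 0 <= r -> (forall k, 0 <= a k) ->
  (forall k, a k ^+ 2 <= a (k + k)%N * a 0%N) ->
  (forall k, a k ^+ Q <= r ^+ k * C) ->
  a 1%N ^+ Q <= r * a 0%N ^+ Q.
Proof.
move=> Q0 r0 a0 aS aC.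
have [a00|a0n] := eqVneq (a 0%N) 0.
  have /eqP : a 1%N ^+ 2 = 0.
    by apply/eqP; rewrite eq_le sqr_ge0 andbT (le_trans (aS _))// a00 mulr0.
  by rewrite expf_eq0 /= => /eqP ->; rewrite a00 expr0n gtn_eqF ?mulr0.
have {}a0n : 0 < a 0%N by rewrite lt_def a0n a0.
pose b k := (a k / a 0%N) ^+ Q.
have b0 k : 0 <= b k by rewrite exprn_ge0// divr_ge0.
have bS k : b k ^+ 2 <= b (k + k)%N.
  rewrite /b -exprM mulnC exprM lerXn2r ?nnegrE ?exprn_ge0 ?divr_ge0//.
  rewrite expr_div_n ler_pdivrMr ?exprn_gt0// expr2 -!mulrA mulKf ?gt_eqF//.
  by rewrite -expr2.
pose C' := C / a 0%N ^+ Q.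
have bC k : b k <= r ^+ k * C'.
  by rewrite /b /C' expr_div_n mulrA ler_pM2r ?invr_gt0 ?exprn_gt0.
have b2 j : b 1%N ^+ (2 ^ j) <= b (2 ^ j)%N.
  elim: j => [//|j IH]; rewrite expnSr exprM muln2 -addnn.
  by apply: le_trans (bS _); apply: lerXn2r; rewrite // nnegrE; last exact: b0;
     apply: exprn_ge0; exact: b0.
suff br : b 1%N <= r.
  by move: br; rewrite /b expr_div_n ler_pdivrMr ?exprn_gt0.
rewrite leNgt; apply/negP => rb.
have [r00|rn] := eqVneq r 0.
  by have := bC 1%N; rewrite r00 expr1 mul0r => /(lt_le_trans rb); rewrite r00 ltxx.
have {}rn : 0 < r by rewrite lt_def rn.
(* the ratio would be 1 + x with x > 0, and Bernoulli's inequality makes (1 + x) ^ (2 ^ j) unbounded *)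
pose x := b 1%N / r - 1.
have x0 : 0 < x by rewrite subr_gt0 ltr_pdivlMr// mul1r.
have key j : x *+ j <= C'.
  apply: (@le_trans _ _ ((1 + x) ^+ (2 ^ j))).
    apply: le_trans (bernoulli_le _ (ltW x0)).
    apply: (@le_trans _ _ (x *+ 2 ^ j)); last by rewrite lerDr.
    by rewrite ler_pMn2l// ltnW// ltn_expl.
  rewrite /x addrCA subrr addr0 expr_div_n ler_pdivrMr ?exprn_gt0// mulrC.
  exact: le_trans (b2 j) (bC _).
have := key (Num.truncn (C' / x)).+1.
by rewrite -mulr_natr mulrC -ler_pdivlMr// leNgt truncnS_gt.
Qed.

Section AveragePowers.
Variables (R : realType) (G : groupType).
Implicit Types (f g : G -> R) (h : nat -> G).

Lemma avg_ge0 n h f : (forall x, 0 <= f x) -> forall x, 0 <= avg n h f x.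
Proof. by move=> f0 x; rewrite mulr_ge0 ?invr_ge0// sumr_ge0. Qed.

Lemma avg_le n h f g : (forall x, f x <= g x) ->
  forall x, avg n h f x <= avg n h g x.
Proof. by move=> fg x; rewrite ler_wpM2l ?invr_ge0// ler_sum. Qed.

(** Only powers of 2 are needed as exponents, so squaring repeatedly replaces
  the general form of Jensen's inequality. *)
Lemma avg_pow2 n h f m x : (forall x, 0 <= f x) ->
  avg n h f x ^+ (2 ^ m) <= avg n h (fun y => f y ^+ (2 ^ m)) x.
Proof.
move=> f0; elim: m => [|m IH]; first by rewrite expr1.
rewrite expnSr exprM.
apply: (@le_trans _ _ (avg n h (fun y => f y ^+ (2 ^ m)) x ^+ 2)).
  rewrite lerXn2r ?nnegrE ?exprn_ge0 ?avg_ge0// => y; exact: exprn_ge0.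
apply: le_trans (jensen_sqr _ (fun i => f ((h i)^-1 * x)%g ^+ (2 ^ m))) _.
by rewrite /avg; under [in leRHS]eq_bigr do rewrite exprM.
Qed.

Lemma conjugatesV (t : nat -> G) (s : G) i :
  ((conjugates t s i)^-1 = conjugates t s^-1 i)%g.
Proof. by rewrite /conjugates !invgM invgK mulgA. Qed.

Variables (n : nat) (t : nat -> G) (s : G).
Let M f := avg n (conjugates t s^-1) (avg n (conjugates t s) f).

Lemma avg2_ge0 k f : (forall x, 0 <= f x) -> forall x, 0 <= iter k M f x.
Proof. by move=> f0; elim: k => //= k IH x; do 2!apply: avg_ge0 => ?. Qed.

Lemma avg2_pow2 k f m x : (forall x, 0 <= f x) ->
  iter k M f x ^+ (2 ^ m) <= iter k M (fun y => f y ^+ (2 ^ m)) x.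
Proof.
move=> f0; elim: k x => [//|k IH] x /=.
have g0 := avg2_ge0 k f0.
apply: le_trans (avg_pow2 _ _ _ _ (avg_ge0 _ _ g0)) _.
apply: avg_le => y; apply: le_trans (avg_pow2 _ _ _ _ g0) _.
exact: avg_le.
Qed.

Lemma sqsum_avg2 k f D (C : R) : (0 < n)%N -> powers_family s t D ->
  (sqsum f <= C%:E)%E ->
  (sqsum (iter k M f) <= (((4 / n%:R) ^+ 2) ^+ k * C)%:E)%E.
Proof.
move=> n0 pf fC; have q0 : 0 <= 4 / n%:R :> R by rewrite divr_ge0.
elim: k => [|k IH]; first by rewrite expr0 mul1r.
apply: le_trans (sqsum_avg _ n0 (powers_familyV pf)) _.
apply: (@le_trans _ _ ((4 / n%:R)%:E * ((4 / n%:R)%:E * sqsum (iter k M f)))%E).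
  by apply: lee_wpmul2l; rewrite ?lee_fin//; exact: sqsum_avg pf.
rewrite exprS -mulrA expr2 -[X in (_ <= X%:E)%E]mulrA !EFinM.
by do 2 (apply: lee_wpmul2l; rewrite ?lee_fin//); rewrite -EFinM.
Qed.

End AveragePowers.

Section RepAverage.
Variables (R : realType) (G : groupType) (H : hilbertType R).
Variable pi : unitary_rep G H.
Implicit Types (x y : H) (h : nat -> G).

Definition rep_avg n h x : H := (n%:R^-1 : R[i]) *: \sum_(i < n) pi (h i) x.

Lemma nrm_rep s x : nrm (pi s x) = nrm x.
Proof.
apply/eqP; rewrite -(@eqrXn2 _ 2) ?nrm_ge0//; apply/eqP/complexI.
by rewrite !nrm_dot rep_dot.
Qed.

Lemma rep_adj s x y : dot (pi s x) y = dot x (pi s^-1%g y).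
Proof. by rewrite -(rep_dot pi s^-1%g) -repM mulVg rep1. Qed.

Lemma rep_avgB n h x y : rep_avg n h (x - y) = rep_avg n h x - rep_avg n h y.
Proof.
rewrite /rep_avg -scalerBr -sumrB; congr (_ *: _).
by apply: eq_bigr => i _; rewrite linearB.
Qed.

Lemma nrm_rep_avg n h x : nrm (rep_avg n h x) <= nrm x.
Proof.
have [->|n0] := posnP n.
  by rewrite /rep_avg big_ord0 scaler0 nrm0 nrm_ge0.
have n1 : 0 < n%:R :> R by rewrite ltr0n.
rewrite nrmZ nrm_natV ler_pdivrMl//.
have -> : n%:R * nrm x = \sum_(i < n) nrm (pi (h i) x).
  by under eq_bigr do rewrite nrm_rep; rewrite sumr_const card_ord mulr_natl.
elim/big_ind2: _ => [|u u' v v' hu hv|//]; first by rewrite nrm0.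
by apply: le_trans (nrmD _ _) _; apply: lerD.
Qed.

Lemma rep_avg_adj n h h' x y : (forall i, (h i)^-1%g = h' i) ->
  dot (rep_avg n h x) y = dot x (rep_avg n h' y).
Proof.
move=> hh'; rewrite dotZl dotZr dot_suml dot_sumr; congr (_ * _).
  by rewrite conj_Creal// realV realn.
by apply: eq_bigr => i _; rewrite rep_adj hh'.
Qed.

Lemma rep_avg_coef n h x y s :
  nrm (dot (rep_avg n h y) (pi s x)) <= avg n h (fun u => nrm (dot y (pi u x))) s.
Proof.
rewrite dotZl nrmM nrm_natV ler_wpM2l ?invr_ge0// dot_suml.
apply: le_trans (nrm_sum _ _) _; apply: ler_sum => i _.
by rewrite rep_adj -repM.
Qed.

(** Let [A] be the averaging operator and [T = A^* A]. The coefficient function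
  of [T ^ k x] is dominated by the [k]-fold average of that of [x]. By Jensen's
  inequality so are their powers of exponent [2 ^ m], and these are
  square-summable functions on which averaging contracts. The moments of [T] at
  [x] therefore decay geometrically, at a rate independent of [x]. *)
Lemma rep_avg_bound_coef n s t D x m (C : R) :
  (0 < n)%N -> powers_family s t D ->
  (sqsum (fun u : G => nrm (dot x (pi u x)) ^+ (2 ^ m))%R <= C%:E)%E ->
  (nrm (rep_avg n (conjugates t s) x) ^+ 2) ^+ (2 ^ m * 2) <=
    (4 / n%:R) ^+ 2 * (nrm x ^+ 2) ^+ (2 ^ m * 2).
Proof.
move=> n0 pf xC; set h := conjugates t s; set h' := conjugates t s^-1%g.
pose T y := rep_avg n h' (rep_avg n h y).
pose M (f : G -> R) := avg n h' (avg n h f).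
pose phi y u : R := nrm (dot y (pi u x)).
pose a k := nrm (dot (iter k T x) x).
have hV i : (h i)^-1%g = h' i := conjugatesV t s i.
have hV' i : (h' i)^-1%g = h i by rewrite -hV invgK.
have Tadj y z : dot (T y) z = dot y (T z).
  by rewrite /T (rep_avg_adj _ _ _ hV') (rep_avg_adj _ _ _ hV).
have Tkadj k y z : dot (iter k T y) z = dot y (iter k T z).
  by elim: k y z => //= k IH y z; rewrite Tadj IH -iterSr.
have phiT k u : phi (iter k T x) u <= iter k M (phi x) u.
  elim: k u => [//|k IH] u /=.
  apply: le_trans (rep_avg_coef _ _ _ _ _) _; apply: avg_le => v.
  apply: le_trans (rep_avg_coef _ _ _ _ _) _; exact: avg_le.
have phi0 u : 0 <= phi x u by exact: nrm_ge0.
have aE k : a k = phi (iter k T x) 1%g by rewrite /a /phi rep1.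
have aC k : a k ^+ (2 ^ m * 2) <= ((4 / n%:R) ^+ 2) ^+ k * C.
  rewrite aE exprM; rewrite -lee_fin.
  apply: le_trans (sqsum_avg2 k n0 pf xC).
  apply: (@le_trans _ _ (iter k M (fun u => phi x u ^+ (2 ^ m)) 1%g ^+ 2)%:E).
    rewrite lee_fin lerXn2r ?nnegrE ?exprn_ge0 ?nrm_ge0//.
      by apply: avg2_ge0 => u; rewrite exprn_ge0.
    apply: le_trans (avg2_pow2 _ _ _ _ _ _ phi0).
    by rewrite lerXn2r ?nnegrE ?nrm_ge0// avg2_ge0.
  pose g : G -> R := iter k M (fun u => phi x u ^+ (2 ^ m)).
  by apply: (@le_esumT _ _ (fun u => (g u ^+ 2)%:E)) => u; rewrite lee_fin sqr_ge0.
have a0 : a 0%N = nrm x ^+ 2.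
  by rewrite /a /= -nrm_dot nrm_real ger0_norm ?sqr_ge0.
have a1 : a 1%N = nrm (rep_avg n h x) ^+ 2.
  by rewrite /a /= /T (rep_avg_adj _ _ _ hV') -nrm_dot nrm_real ger0_norm ?sqr_ge0.
rewrite -a0 -a1; apply: (@moment_bound _ _ _ C).
- by rewrite muln_gt0 expn_gt0.
- exact: sqr_ge0.
- by move=> k; exact: nrm_ge0.
- move=> k; have -> : a (k + k)%N = nrm (iter k T x) ^+ 2.
    by rewrite /a iterD Tkadj -nrm_dot nrm_real ger0_norm ?sqr_ge0.
  by rewrite a0 -exprMn lerXn2r ?nnegrE ?mulr_ge0 ?nrm_ge0// dot_Cauchy_Schwarz.
- exact: aC.
Qed.

(** A coefficient in l_p is bounded, hence lies in l_q for every [q >= p]; here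
  [q] is twice a power of 2. *)
Lemma coef_sqsum p x m : 0 <= p <= (2 ^ m * 2)%:R -> ell p (rep_coef pi x x) ->
  exists C : R, (sqsum (fun u : G => nrm (dot x (pi u x)) ^+ (2 ^ m))%R <= C%:E)%E.
Proof.
move=> /andP[p0 pm] lpx; pose Q : R := (2 ^ m * 2)%:R.
have B0 : 0 <= nrm x ^+ 2 by exact: sqr_ge0.
have cE u : nrm (dot x (pi u x)) = nrm (rep_coef pi x x u).
  by rewrite dotC nrmJ.
have le u : (nrm (dot x (pi u x)) ^+ (2 ^ m)) ^+ 2 <=
    (nrm x ^+ 2) `^ (Q - p) * nrm (rep_coef pi x x u) `^ p.
  rewrite -exprM -powR_mulrn ?nrm_ge0// -/Q cE.
  have c0 := nrm_ge0 (rep_coef pi x x u).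
  rewrite -[X in _ `^ X <= _](subrK p) [leLHS]powRD; last first.
    by rewrite subrK pnatr_eq0 muln_eq0 expn_eq0.
  rewrite ler_wpM2r ?powR_ge0// ge0_ler_powR ?nnegrE ?subr_ge0//.
  by apply: le_trans (dot_Cauchy_Schwarz _ _) _; rewrite nrm_rep -expr2.
have k0 : 0 <= (nrm x ^+ 2) `^ (Q - p) by exact: powR_ge0.
move: lpx; rewrite /ell summableE.
under eq_esum do rewrite gee0_abs ?lee_fin ?powR_ge0//.
move=> /fineK Sfin; set S := esum _ _ in Sfin.
exists ((nrm x ^+ 2) `^ (Q - p) * fine S); rewrite EFinM Sfin.
apply: le_trans (esumZ_le _ _) => //; last by move=> u; rewrite lee_fin powR_ge0.
by apply: le_esum => u _; rewrite -EFinM lee_fin.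
Qed.

(** The bound of [rep_avg_bound_coef] is free of the constant [C], which depends
  on the vector, so it extends from the dense subspace to the whole space. *)
Lemma lp_rep_avg_bound n p s t D m (e : R) x :
  (0 < n)%N -> powers_family s t D -> 0 <= p <= (2 ^ m * 2)%:R ->
  lp_rep p pi -> 0 < e -> 4 / n%:R <= e ^+ (2 ^ m * 2) ->
  nrm (rep_avg n (conjugates t s) x) <= e * nrm x.
Proof.
move=> n0 pf pm [H0 [_ dH0 lpH0]] e0 en; set A := rep_avg _ _.
have on0 y : H0 y -> nrm (A y) <= e * nrm y.
  move=> Hy; have [C yC] := coef_sqsum pm (lpH0 _ _ Hy Hy).
  have := rep_avg_bound_coef n0 pf yC; rewrite -/A => h.
  have {h} : (nrm (A y) ^+ 2) ^+ (2 ^ m * 2) <= ((e * nrm y) ^+ 2) ^+ (2 ^ m * 2).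
    apply: le_trans h _; rewrite [(e * _) ^+ 2]exprMn [leRHS]exprMn ler_wpM2r//.
      by rewrite exprn_ge0// sqr_ge0.
    rewrite -[leRHS]exprM mulnC exprM lerXn2r ?nnegrE ?divr_ge0//.
    by rewrite exprn_ge0// ltW.
  rewrite ler_pXn2r ?nnegrE ?sqr_ge0 ?muln_gt0 ?expn_gt0//.
  by rewrite ler_sqr// nnegrE ?nrm_ge0// mulr_ge0 ?nrm_ge0// ltW.
apply/ler_addgt0Pr => c c0.
pose dl := c / (1 + e).
have dl0 : 0 < dl by rewrite divr_gt0// addr_gt0.
have [y [xy Hy]] : exists y, nrm (x - y) < dl /\ H0 y.
  have [] := dH0 (ball x dl%:C%C).
  - by exists x; apply: ballxx; rewrite ltcR.
  - exact: ball_open.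
  move=> y [bxy Hy]; exists y; split=> //.
  by move: bxy; rewrite -ball_normE /ball_ /= nrmE ltcR.
have := on0 _ Hy; have := nrm_rep_avg n (conjugates t s) (x - y).
rewrite rep_avgB -/A => h1 h2.
have : nrm (A x) <= nrm (A x - A y) + nrm (A y).
  by rewrite -[X in nrm X <= _](subrK (A y)) nrmD.
have : nrm y <= nrm x + nrm (x - y).
  by rewrite -{1}(subKr x y) -(nrmN (x - y)) nrmD.
have dlE : dl + e * dl = c.
  by rewrite /dl; field; rewrite gt_eqF// addr_gt0.
nra.
Qed.

End RepAverage.

(** * The trace of the group algebra *)

Section GroupAlg.
Variables (R : realType) (G : groupType).
Local Notation CG := (group_alg R G).
Implicit Types (f g : CG) (s t : G) (c : R[i]).

Definition ga_tr f : R[i] := f@_(1%g : G).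

Lemma ga_trD f g : ga_tr (f + g) = ga_tr f + ga_tr g.
Proof. exact: mcoeffD. Qed.

Lemma ga_trZ c f : ga_tr (c *: f) = c * ga_tr f.
Proof. exact: mcoeffZ. Qed.

Lemma ga_trB f g : ga_tr (f - g) = ga_tr f - ga_tr g.
Proof. exact: mcoeffB. Qed.

Lemma ga_tr1 : ga_tr 1 = 1.
Proof. by rewrite /ga_tr mcoeffU eqxx. Qed.

Lemma ga_UU c c' s t :
  (<< c *g s >> : CG) * << c' *g t >> = << c * c' *g (s * t)%g >>.
Proof. exact: ga_mulUU. Qed.

Lemma ga_trC f g : ga_tr (f * g) = ga_tr (g * f).
Proof.
elim/ga_ind: f => [f f' Hf Hf'|c s]; first by rewrite mulrDl mulrDr !ga_trD Hf Hf'.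
elim/ga_ind: g => [g g' Hg Hg'|c' t]; first by rewrite mulrDl mulrDr !ga_trD Hg Hg'.
rewrite !ga_UU /ga_tr !mcoeffU mulrC; congr (_ *+ nat_of_bool _).
by rewrite -(inj_eq (mulgI s^-1%g)) mulKg mulg1 -(inj_eq (mulIg s)) mulVg.
Qed.

Lemma ga_coefUM c s g t : ((<< c *g s >> : CG) * g)@_t = c * g@_(s^-1 * t)%g.
Proof.
elim/ga_ind: g => [g g' Hg Hg'|c' u]; first by rewrite mulrDr !mcoeffD mulrDr Hg Hg'.
rewrite ga_UU !mcoeffU mulrnAr; congr (_ *+ nat_of_bool _).
by rewrite -(inj_eq (mulgI s) u) mulVKg.
Qed.

Lemma ga_tr_star_ge0 f : 0 <= ga_tr (star f * f).
Proof.
rewrite /ga_tr /star /= /ga_star mulr_suml raddf_sum sumr_ge0// => s _ /=.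
by rewrite ga_coefUM invgK mulg1 mulrC -normCK exprn_ge0.
Qed.

Section RepAlg.
Variables (H : hilbertType R) (pi : unitary_rep G H).

Lemma rep_algw (d : {fset G}) f x : (msupp f `<=` d)%fset ->
  rep_alg pi f x = \sum_(s <- d) f@_s *: pi s x.
Proof.
move=> fd; apply: big_fset_incl => // s _ /mcoeff_outdom ->.
by rewrite scale0r.
Qed.

Lemma rep_algD f g x : rep_alg pi (f + g) x = rep_alg pi f x + rep_alg pi g x.
Proof.
rewrite (@rep_algw (msupp f `|` msupp g)%fset) ?msuppD_le//.
rewrite (@rep_algw (msupp f `|` msupp g)%fset f) ?fsubsetUl//.
rewrite (@rep_algw (msupp f `|` msupp g)%fset g) ?fsubsetUr// -big_split.
by apply: eq_bigr => s _; rewrite mcoeffD scalerDl.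
Qed.

Lemma rep_algU c s x : rep_alg pi << c *g s >> x = c *: pi s x.
Proof. by rewrite (rep_algw _ msuppU_le) big_seq_fset1 mcoeffUU. Qed.

Lemma rep_alg_sum n (F : 'I_n -> CG) x :
  rep_alg pi (\sum_(i < n) F i) x = \sum_(i < n) rep_alg pi (F i) x.
Proof.
apply: (big_morph (fun f => rep_alg pi f x) (fun f g => rep_algD f g x)).
by rewrite /rep_alg msupp0 big_seq_fset0.
Qed.

End RepAlg.

Definition ga_avg n (h : nat -> G) : CG :=
  \sum_(i < n) << (n%:R^-1 : R[i]) *g h i >>.

Lemma rep_alg_avg (H : hilbertType R) (pi : unitary_rep G H) n h x :
  rep_alg pi (ga_avg n h) x = rep_avg pi n h x.
Proof.
rewrite rep_alg_sum /rep_avg scaler_sumr.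
by apply: eq_bigr => i _; rewrite rep_algU.
Qed.

Lemma sup_le_nonneg (A : set R) (x : R) : 0 <= x -> ubound A x -> sup A <= x.
Proof.
move=> x0 Ax; have [->|A0] := eqVneq A set0; first by rewrite sup0.
by apply: ge_sup => //; apply/set0P.
Qed.

Lemma lp_norm_avg n p s (t : nat -> G) D m (e : R) :
  (0 < n)%N -> powers_family s t D -> 0 <= p <= (2 ^ m * 2)%:R ->
  0 < e -> 4 / n%:R <= e ^+ (2 ^ m * 2) ->
  lp_norm p (ga_avg n (conjugates t s)) <= e.
Proof.
move=> n0 pf pm e0 en; apply: sup_le_nonneg; first exact: ltW.
move=> _ [H [pi [lppi ->]]]; apply: sup_le_nonneg; first exact: ltW.
move=> _ [x /= x1 <-]; rewrite rep_alg_avg.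
apply: le_trans (lp_rep_avg_bound _ n0 pf pm lppi e0 en) _.
by rewrite ler_piMr// ltW.
Qed.

Section Regular.
Implicit Type xi : G -> R[i].

Lemma lreg_alg_sqsum f xi :
  (sqsum (fun t => nrm (lreg_alg f xi t)) <=
   ((size (msupp f))%:R * \sum_(s <- msupp f) nrm f@_s ^+ 2)%:E *
     sqsum (fun t => nrm (xi t)))%E.
Proof.
pose g s t : \bar R := ((nrm (f@_s) ^+ 2)%:E * (nrm (xi (s^-1 * t)%g) ^+ 2)%:E)%E.
have g0 s t : (0 <= g s t)%E by rewrite mule_ge0 ?lee_fin ?sqr_ge0.
apply: (@le_trans _ _ (\esum_(t in [set: G]%classic)
    ((size (msupp f))%:R%:E * \sum_(s <- msupp f) g s t))%E).
  apply: le_esum => t _; rewrite /g.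
  under eq_bigr do rewrite -EFinM -exprMn -nrmM.
  rewrite sumEFin -EFinM lee_fin.
  apply: le_trans (sqr_sum_le _ (fun s => nrm (f@_s * xi (s^-1 * t)%g))).
  by rewrite lerXn2r ?nnegrE ?nrm_ge0 ?sumr_ge0 ?nrm_sum// => s _; exact: nrm_ge0.
apply: le_trans (esumZ_le _ _) _ => // [t|]; first exact: sume_ge0.
rewrite EFinM -muleA; apply: lee_wpmul2l; rewrite ?lee_fin//.
rewrite esum_sum// -sumEFin ge0_sume_distrl; last by move=> s _; rewrite lee_fin sqr_ge0.
apply: lee_sum => s _; rewrite /sqsum -(esum_translate s^-1%g (fun t => (nrm (xi t) ^+ 2)%:E)).
by apply: esumZ_le => [|t]; rewrite ?lee_fin sqr_ge0.
Qed.

Lemma ell2_norm_le xi (C : R) :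
  (sqsum (fun t => nrm (xi t)) <= C%:E)%E -> ell2_norm xi <= Num.sqrt C.
Proof.
move=> h; rewrite /ell2_norm ler_wsqrtr//.
have fin : sqsum (fun t => nrm (xi t)) \is a fin_num.
  by rewrite ge0_fin_numE ?sqsum_ge0// (le_lt_trans h)// ltry.
by rewrite -lee_fin fineK.
Qed.

Lemma ell2_unit xi : ell 2 xi -> ell2_norm xi <= 1 ->
  (sqsum (fun t => nrm (xi t)) <= 1%:E)%E.
Proof.
rewrite /ell summableE => xi2.
have fin : sqsum (fun t => nrm (xi t)) \is a fin_num.
  rewrite (_ : sqsum _ = \esum_(t in [set: G]%classic) `|(nrm (xi t) `^ 2)%:E|%E)//.
  apply: eq_esum => t _; rewrite gee0_abs ?lee_fin ?powR_ge0//.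
  by rewrite (powR_mulrn 2) ?nrm_ge0.
rewrite /ell2_norm -ler_sqr ?nnegrE ?sqrtr_ge0// expr1n.
rewrite sqr_sqrtr ?fine_ge0 ?sqsum_ge0// => h.
by rewrite -(fineK fin) lee_fin.
Qed.

Lemma ga_tr_le_reduced f : nrm (ga_tr f) <= reduced_norm f.
Proof.
pose K := (size (msupp f))%:R * \sum_(s <- msupp f) nrm f@_s ^+ 2.
have K0 : 0 <= K by rewrite mulr_ge0// sumr_ge0// => s _; exact: sqr_ge0.
have bd xi : ell 2 xi -> ell2_norm xi <= 1 ->
    (sqsum (fun t => nrm (lreg_alg f xi t)) <= K%:E)%E.
  move=> xi2 /(ell2_unit xi2) h; apply: le_trans (lreg_alg_sqsum _ _) _.
  by rewrite -[leRHS]mule1; apply: lee_wpmul2l; rewrite ?lee_fin.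
(* lambda(f) maps delta, the unit mass at 1, to f itself *)
pose delta (t : G) : R[i] := (t == 1%g)%:R.
(* F is used as squaring, written as a natural or as a real power *)
have dsq (F : R -> R) : F 0 = 0 -> F 1 = 1 ->
    (\esum_(t in [set: G]%classic) (F (nrm (delta t)))%:E = 1%:E)%E.
  move=> F0 F1; rewrite (esumID [set 1%g]%classic)//; last first.
    by move=> t _; rewrite /delta; case: (t == 1%g); rewrite (nrm_nat, nrm0) ?F1 ?F0 lee_fin.
  rewrite setTI esum_set1; last by rewrite /delta eqxx nrm_nat F1 lee_fin.
  rewrite esum1 ?adde0 => [|t /= [_ /eqP /negPf t1]].
    by rewrite /delta eqxx nrm_nat F1.
  by rewrite /delta t1 nrm0 F0.
have d2 : ell 2 delta.
  rewrite /ell /summable.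
  under eq_esum do rewrite gee0_abs ?lee_fin ?powR_ge0//.
  by rewrite (dsq (fun x => x `^ 2)) ?ltry// ?powR0 ?pnatr_eq0// powR1.
have d1 : ell2_norm delta <= 1.
  rewrite -[leRHS]sqrtr1; apply: ell2_norm_le.
  by rewrite /sqsum (dsq (fun x => x ^+ 2)) ?expr0n ?expr1n.
have dE : lreg_alg f delta 1%g = ga_tr f.
  rewrite /lreg_alg /ga_tr {3}(monalgE f) raddf_sum /=.
  apply: eq_bigr => s _; rewrite /lreg /delta mcoeffU mulg1 mulr_natr.
  by rewrite invg_eq1.
apply: (@le_trans _ _ (ell2_norm (lreg_alg f delta))).
  rewrite /ell2_norm -(ger0_norm (nrm_ge0 (ga_tr f))) -sqrtr_sqr ler_wsqrtr//.
  have fin : sqsum (fun t => nrm (lreg_alg f delta t)) \is a fin_num.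
    by rewrite ge0_fin_numE ?sqsum_ge0// (le_lt_trans (bd _ d2 d1))// ltry.
  rewrite -lee_fin fineK// -dE.
  apply: (@le_esumT _ _ (fun t => (nrm (lreg_alg f delta t) ^+ 2)%:E)) => t.
  by rewrite lee_fin sqr_ge0.
rewrite /reduced_norm; set A := (X in sup X).
have ubA : has_ubound A.
  by exists (Num.sqrt K) => _ [xi [xi2 xi1] <-]; apply: ell2_norm_le; exact: bd.
by apply: (ub_le_sup ubA); exists delta.
Qed.

End Regular.
End GroupAlg.

(** * Extension by density *)

Section Completion.
Variables (R : realType) (G : groupType) (N : group_alg R G -> R).
Variables (A : cstarAlgType R) (i : {lrmorphism group_alg R G -> A}).
Hypothesis iN : is_completion N i.
Local Notation CG := (group_alg R G).
Implicit Types (f g : CG) (a b : A).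

Lemma completion_dense a (e : R) : 0 < e -> exists f, cnorm (a - i f) < e.
Proof. by case: iN => _ _; apply. Qed.

Definition lipschitz_fun (F : A -> R[i]) :=
  exists2 K : R, 0 <= K & forall a b, nrm (F a - F b) <= K * cnorm (a - b).

Lemma lipschitz_dense_eq (F1 F2 : A -> R[i]) :
  lipschitz_fun F1 -> lipschitz_fun F2 -> (forall f, F1 (i f) = F2 (i f)) ->
  forall a, F1 a = F2 a.
Proof.
move=> [K1 K10 l1] [K2 K20 l2] F12 a; apply/eqP; rewrite -subr_eq0; apply/eqP.
apply: (@nrm_le_eps _ (K1 + K2)); first exact: addr_ge0.
move=> e /(completion_dense a)[f /ltW af].
have -> : F1 a - F2 a = (F1 a - F1 (i f)) + - (F2 a - F2 (i f)).
  by rewrite F12 opprB addrA subrK.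
apply: le_trans (nrmD _ _) _; rewrite nrmN mulrDl.
by apply: lerD; [apply: le_trans (l1 _ _) _|apply: le_trans (l2 _ _) _];
   rewrite ler_wpM2l.
Qed.

Lemma scalar_lipschitz (F : A -> R[i]) (K : R) : scalar F -> 0 <= K ->
  (forall a, nrm (F a) <= K * cnorm a) -> lipschitz_fun F.
Proof.
move=> Fl K0 FK; exists K => // a b.
have -> : F a - F b = F (a - b); last exact: FK.
by rewrite addrC -[in RHS]scaleN1r [in RHS]addrC Fl mulN1r.
Qed.

(** A Lipschitz function on a subset of a metric space extends with the same
  constant, the extension at [a] being the supremum of the lower bounds that
  the known values impose. *)
Lemma lipschitz_extend (L : CG -> R) a :
  (forall f g, L f - L g <= cnorm (i f - i g)) ->
  exists c, forall f, `|L f - c| <= cnorm (a - i f).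
Proof.
move=> Ll; pose S := [set L g - cnorm (a - i g) | g in [set: CG]]%classic.
have Sub f : ubound S (L f + cnorm (a - i f)).
  move=> _ [g _ <-]; have := Ll g f.
  have := cnorm_triangle a (i g) (i f); rewrite (cnormB (i g) a); lra.
exists (sup S) => f; rewrite ler_distl; apply/andP; split; last first.
  rewrite -lerBlDr; apply: (ub_le_sup (ex_intro _ _ (Sub 0))).
  by exists f.
rewrite lerBlDr; apply: ge_sup; last exact: Sub.
by exists (L 0 - cnorm (a - i 0)), 0.
Qed.

(** The coefficient at 1 is Lipschitz for the norm, so it extends to the
  completion; the identities and the positivity then pass to the limit. *)
Lemma trace_extend : (forall f, nrm (ga_tr f) <= N f) ->
  exists tau : A -> R[i], tracial_state tau /\ forall f, tau (i f) = ga_tr f.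
Proof.
move=> trN; case: (iN) => istar inorm _.
have tr_le f g : nrm (ga_tr f - ga_tr g) <= cnorm (i f - i g).
  by rewrite -ga_trB -raddfB inorm.
have ex a : exists c : R[i], forall f, nrm (ga_tr f - c) <= 2 * cnorm (a - i f).
  have [|c1 h1] := @lipschitz_extend (fun f => complex.Re (ga_tr f)) a.
    move=> f g; apply: le_trans (tr_le f g); rewrite -raddfB.
    exact: le_trans (ler_norm _) (nrm_Re _).
  have [|c2 h2] := @lipschitz_extend (fun f => complex.Im (ga_tr f)) a.
    move=> f g; apply: le_trans (tr_le f g); rewrite -raddfB.
    exact: le_trans (ler_norm _) (nrm_Im _).
  exists (Complex c1 c2) => f; apply: le_trans (nrm_le_ReIm _) _.
  by rewrite !raddfB /= mulr_natl mulr2n lerD.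
have [tau tauP] := choice ex.
have tauE f : tau (i f) = ga_tr f.
  apply/esym/eqP; rewrite -subr_eq0 -nrm_eq0 eq_le nrm_ge0 andbT.
  by apply: le_trans (tauP _ _) _; rewrite subrr cnorm0 mulr0.
have tauL : scalar tau.
  move=> k a b; apply/eqP; rewrite -subr_eq0; apply/eqP.
  have k0 := nrm_ge0 k.
  apply: (@nrm_le_eps _ (4 * (nrm k + 1))); first by rewrite mulr_ge0// addr_ge0.
  move=> e e0; have [f /ltW af] := completion_dense a e0.
  have [g /ltW bg] := completion_dense b e0.
  have h : cnorm (k *: a + b - i (k *: f + g)) <= nrm k * e + e.
    rewrite linearP opprD addrACA -scalerBr; apply: le_trans (cnormD _ _) _.
    by rewrite cnormZ lerD// ler_wpM2l.
  have h1 := tauP (k *: a + b) (k *: f + g).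
  have h2 := tauP a f; have h3 := tauP b g.
  have -> : tau (k *: a + b) - (k * tau a + tau b) =
      - (ga_tr (k *: f + g) - tau (k *: a + b)) +
      (k * (ga_tr f - tau a) + (ga_tr g - tau b)).
    by rewrite ga_trD ga_trZ; ring.
  apply: le_trans (nrmD _ _) _; rewrite nrmN.
  have := nrmD (k * (ga_tr f - tau a)) (ga_tr g - tau b); rewrite nrmM.
  have : nrm k * nrm (ga_tr f - tau a) <= nrm k * (2 * e).
    by rewrite ler_wpM2l// (le_trans h2)// ler_wpM2l.
  lra.
have tauB a : nrm (tau a) <= 2 * cnorm a.
  have := tauP a 0; rewrite raddf0 subr0 /ga_tr mcoeff0 sub0r nrmN.
  exact.
exists tau; split=> //; split=> //.
- by rewrite -(rmorph1 i) tauE ga_tr1.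
- move=> a.
  have key (e : R) : 0 < e -> exists2 c : R[i], 0 <= c & nrm (tau (star a * a) - c) <= e.
    move=> e0; pose na := cnorm a; have na0 : 0 <= na := cnorm_ge0 a.
    (* bounds cnorm (star a * a - i (star f * f)) by e / 2 if f is dl-close to a *)
    pose dl := Num.min 1 (e / (2 * (2 * na + 1))).
    have q0 : 0 < 2 * (2 * na + 1) by rewrite mulr_gt0// ltr_wpDl// mulr_ge0.
    have dl0 : 0 < dl by rewrite lt_min ltr01 divr_gt0.
    have dl1 : dl <= 1 by rewrite ge_min lexx.
    have dle : dl * (2 * (2 * na + 1)) <= e.
      by rewrite -ler_pdivlMr// ge_min lexx orbT.
    have [f /ltW af] := completion_dense a dl0.
    exists (ga_tr (star f * f)); first exact: ga_tr_star_ge0.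
    rewrite -opprB nrmN; apply: le_trans (tauP _ _) _.
    have -> : i (star f * f) = star (i f) * i f.
      by rewrite rmorphM; congr (_ * _); exact: istar.
    have -> : star a * a - star (i f) * i f =
        star a * (a - i f) + star (a - i f) * i f.
      by rewrite starB mulrBr mulrBl addrA subrK.
    have nf : cnorm (i f) <= na + dl.
      have := cnorm_triangle a (i f) 0; rewrite !subr0 cnormB -/na; lra.
    have := cnormD (star a * (a - i f)) (star (a - i f) * i f).
    have := cnormM (star a) (a - i f); have := cnormM (star (a - i f)) (i f).
    rewrite !cnorm_starE -/na.
    have := cnorm_ge0 (i f); have := cnorm_ge0 (a - i f); nra.
  have im0 : complex.Im (tau (star a * a)) = 0.
    apply/eqP; rewrite -normr_eq0 eq_le normr_ge0 andbT.
    apply/ler_addgt0Pl => e /key[c /ger0_Im c0 h]; rewrite addr0.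
    by apply: le_trans h; apply: le_trans (nrm_Im _); rewrite raddfB /= c0 subr0.
  rewrite lecE /= im0 eqxx /=; apply/ler_addgt0Pl => e /key[c c0 h].
  have : 0 <= complex.Re c by move: c0; rewrite lecE => /andP[].
  have := le_trans (nrm_Re _) h; rewrite raddfB /= ler_distlC => /andP[]; lra.
- have lipM a : lipschitz_fun (fun b => tau (a * b)).
    apply: (@scalar_lipschitz _ (2 * cnorm a)); rewrite ?mulr_ge0 ?cnorm_ge0//.
      by move=> k b c; rewrite mulrDr -scalerAr tauL.
    move=> b; apply: le_trans (tauB _) _; rewrite -mulrA ler_wpM2l//.
    exact: cnormM.
  have lipMr a : lipschitz_fun (fun b => tau (b * a)).
    apply: (@scalar_lipschitz _ (2 * cnorm a)); rewrite ?mulr_ge0 ?cnorm_ge0//.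
      by move=> k b c; rewrite mulrDl -scalerAl tauL.
    move=> b; apply: le_trans (tauB _) _; rewrite -mulrA ler_wpM2l// mulrC.
    exact: cnormM.
  have half f b : tau (i f * b) = tau (b * i f).
    apply: (lipschitz_dense_eq (lipM (i f)) (lipMr (i f))) => g.
    by rewrite -!rmorphM !tauE ga_trC.
  move=> a b; apply: (lipschitz_dense_eq (lipMr b) (lipM b)) => f.
  exact: half.
Qed.

End Completion.

(** * Uniqueness of the trace *)

Lemma tracial_state_lipschitz (R : realType) (A : cstarAlgType R)
    (sigma : A -> R[i]) : tracial_state sigma -> lipschitz_fun sigma.
Proof.
move=> [sL s1 sp _]; apply: (@scalar_lipschitz _ _ _ 8) => //.
exact: positive_functional_bounded.
Qed.

Section Uniqueness.
Variables (R : realType) (d : nat) (p : R) (A : cstarAlgType R).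
Local Notation Fd := (free_group d).
Variable i : {lrmorphism group_alg R Fd -> A}.
Hypotheses (d2 : (2 <= d)%N) (p2 : 2 <= p) (iN : is_completion (lp_norm p) i).

(** All conjugates of [s] have the same trace as [s], hence so has the average of
  any number of them; but the norm of a suitable average is as small as
  desired. *)
Lemma tracial_state_lp (sigma : A -> R[i]) f :
  tracial_state sigma -> sigma (i f) = ga_tr f.
Proof.
move=> [sL s1 sp sC].
have sb := positive_functional_bounded sL s1 sp.
pose sigmaL : {scalar A} := HB.pack sigma (GRing.isLinear.Build _ _ _ _ sigma sL).
have sD a b : sigma (a + b) = sigma a + sigma b := raddfD sigmaL a b.
have sZ (c : R[i]) a : sigma (c *: a) = c * sigma a := linearZ_LR sigmaL c a.
pose phi g := sigma (i g).
have phiD g h : phi (g + h) = phi g + phi h by rewrite /phi raddfD sD.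
have phiZ (c : R[i]) g : phi (c *: g) = c * phi g by rewrite /phi linearZ sZ.
have phi0 : phi 0 = 0 by rewrite -[X in phi X](scale0r 0) phiZ mul0r.
have phiS n (F : 'I_n -> _) : phi (\sum_(j < n) F j) = \sum_(j < n) phi (F j).
  exact: (big_morph phi phiD phi0).
have UE c s : (<< c *g s >> : group_alg R Fd) = c *: << 1 *g s >>.
  by rewrite ga_scaleU mulr1.
have zero s : s != 1%g -> phi << 1 *g s >> = 0.
  move=> s1'; have [t [D pf]] := free_powers_family d2 s1'.
  have [m pm] : exists m, p <= (2 ^ m * 2)%:R.
    exists (Num.truncn p).+1; apply: ltW; apply: lt_le_trans (truncnS_gt _) _.
    set k := _.+1; rewrite ler_nat; apply: leq_trans (leq_pmulr _ _) => //.
    by rewrite ltnW// ltn_expl.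
  apply: (@nrm_le_eps _ 8) => // e e0.
  have [n n0 en] : exists2 n, (0 < n)%N & 4 / n%:R <= e ^+ (2 ^ m * 2).
    have E0 : 0 < e ^+ (2 ^ m * 2) by exact: exprn_gt0.
    exists (Num.truncn (4 / e ^+ (2 ^ m * 2))).+1 => //.
    rewrite ler_pdivrMr ?ltr0n// mulrC -ler_pdivrMr//.
    exact/ltW/truncnS_gt.
  have conj j : phi << 1 *g conjugates t s j >> = phi << 1 *g s >>.
    rewrite /phi /conjugates -[X in << X *g _ >>](mulr1 (1 : R[i])) -ga_UU rmorphM sC.
    by rewrite -rmorphM ga_UU mul1r mulKg.
  have -> : phi << 1 *g s >> = phi (ga_avg R n (conjugates t s)).
    rewrite /ga_avg phiS; under eq_bigr do rewrite UE phiZ conj.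
    rewrite sumr_const card_ord -mulrnAl -[X in X * _]mulr_natr mulVf ?mul1r//.
    by rewrite pnatr_eq0 -lt0n.
  apply: le_trans (sb _) _; rewrite ler_wpM2l//.
  case: iN => _ -> _; apply: lp_norm_avg pf _ e0 en => //.
  by rewrite pm andbT (le_trans _ p2).
rewrite -/(phi f).
elim/ga_ind: f => [f g Hf Hg|c s]; first by rewrite phiD Hf Hg ga_trD.
rewrite UE phiZ ga_trZ; congr (_ * _).
have [->|s1'] := eqVneq s 1%g; first by rewrite /phi (rmorph1 i) s1 ga_tr1.
by rewrite zero// /ga_tr mcoeffU (negPf s1').
Qed.

Lemma tracial_state_lp_unique (sigma sigma' : A -> R[i]) :
  tracial_state sigma -> tracial_state sigma' -> sigma = sigma'.
Proof.
move=> hs hs'; apply/funext => a.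
apply: (lipschitz_dense_eq iN) a => [||f]; try exact: tracial_state_lipschitz.
by rewrite !tracial_state_lp.
Qed.

End Uniqueness.

Theorem corollary3p9 (R : realType) (d : nat) (p : R)
    (Clp Cred : cstarAlgType R)
    (i_p : {lrmorphism group_alg R (free_group d) -> Clp})
    (i_red : {lrmorphism group_alg R (free_group d) -> Cred})
    (lambda_p : {lrmorphism Clp -> Cred}) :
  (2 <= d)%N -> 2 <= p ->
  is_completion (lp_norm p) i_p ->
  is_completion (@reduced_norm R _) i_red ->
  canonical_quotient i_p i_red lambda_p ->
  exists tau : Cred -> R[i],
    unique_tracial_state tau /\ unique_tracial_state (tau \o lambda_p).
Proof.
move=> d2 p2 pC redC [lstar lE lsurj].
have [tau [tauT _]] := trace_extend redC (@ga_tr_le_reduced R _).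
have pull (sigma : Cred -> R[i]) :
    tracial_state sigma -> tracial_state (sigma \o lambda_p).
  move=> [sL s1 sp sC]; split=> /=.
  - by move=> k a b /=; rewrite linearP sL.
  - by rewrite rmorph1.
  - move=> a; have -> : lambda_p (star a * a) = star (lambda_p a) * lambda_p a.
      by rewrite rmorphM; congr (_ * _); exact: lstar.
    exact: sp.
  - by move=> a b; rewrite !rmorphM sC.
have uniq := tracial_state_lp_unique d2 p2 pC.
exists tau; split; split=> //; last 2 first.
- exact: pull.
- by move=> sigma sigmaT; apply: uniq => //; exact: pull.
move=> sigma sigmaT; apply/funext => b; have [a <-] := lsurj b.
by have /(congr1 (@^~ a)) := uniq _ _ (pull _ sigmaT) (pull _ tauT).
Qed.
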